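(* Let $d_0=\min\{d,M\}$, suppose $R_{\min}=\tilde{\Omega}(\sqrt{d_0})$ and $a\le \frac{R_{\min}}{2}-\sqrt{d_0}\,O\big(\sqrt{\log(\max\{M^2\kappa/\pi_{\min},R_{\max},d_0\})}\big)$, and let $\mathbb{A}=\prod_{i=1}^M\mathbb{B}(\mu_i^*,a)$. Let $X_1,\dots,X_n$ be i.i.d. from $\mathrm{GMM}(\pi,\mu^*,I_d)$. Then there are constants $c,c'>0$ such that with probability at least $1-\exp(-c'd\log n)$, $$\sup_{\mu\in\mathbb{A}}\|G^{(i)}(\mu)-G_n^{(i)}(\mu)\|<\epsilon^{\mathrm{unif}}(n)\qquad\forall i\in[M],\qquad \epsilon^{\mathrm{unif}}(n)=cM^{3/2}(1+3R_{\max})^3\max\{1,\log(\kappa)\}\sqrt{\frac{d\log n}{n}}.$$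
   Context: Fix integers $M\ge 2$, $d\ge1$; weights $\pi_i>0$, $\sum_i\pi_i=1$; centers $\mu_i^*\in\mathbb{R}^d$ with $\sum_i\pi_i\mu_i^*=0$; $\mathrm{GMM}(\pi,\mu^*,I_d)$ has density $\sum_i\pi_i\phi(x\mid\mu_i^*,I_d)$. For stacked $\mu\in\mathbb{R}^{Md}$, $w_i(x;\mu)=\frac{\pi_i\phi(x\mid\mu_i,I_d)}{\sum_j\pi_j\phi(x\mid\mu_j,I_d)}$; $G^{(i)}(\mu)=\mathbb{E}_X[w_i(X;\mu)(X-\mu_i)]$ with $X\sim\mathrm{GMM}(\pi,\mu^*,I_d)$ and $G_n^{(i)}(\mu)=\frac1n\sum_{j=1}^nw_i(X_j;\mu)(X_j-\mu_i)$. $R_{\max}=\max_{i\ne j}\|\mu_i^*-\mu_j^*\|$, $R_{\min}=\min_{i\ne j}\|\mu_i^*-\mu_j^*\|$, $\pi_{\max},\pi_{\min}$ largest/smallest weights, $\kappa=\pi_{\max}/\pi_{\min}$. $O$ hides universal constants; $\tilde\Omega$ ignores logarithmic factors. *)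

(* Defs.v *)
From HB Require Import structures.
From mathcomp Require Import all_boot all_order all_algebra.
From mathcomp Require Import all_classical all_reals all_analysis.
Set Implicit Arguments. Unset Strict Implicit. Unset Printing Implicit Defensive.
Import Order.TTheory GRing.Theory Num.Theory.
Import numFieldNormedType.Exports.
Local Open Scope classical_set_scope.
Local Open Scope ring_scope.

Section GMM.
Variable R : realType.

(* vectors of R^d are functions 'I_d -> R; data points are d.-tuples
   (which carry the product sigma-algebra of the library) *)
Definition enorm (d : nat) (v : 'I_d -> R) : R :=
  Num.sqrt (\sum_(k < d) v k ^+ 2).

Definition phi (d : nat) (x : 'I_d -> R) (m : 'I_d -> R) : R :=
  \prod_(k < d) normal_pdf (m k) 1 (x k).

Definition wgt (M d : nat) (pi : 'I_M -> R) (i : 'I_M)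
    (x : 'I_d -> R) (mu : 'I_M -> 'I_d -> R) : R :=
  pi i * phi x (mu i) / \sum_(j < M) pi j * phi x (mu j).

Definition Rmax (M d : nat) (mus : 'I_M -> 'I_d -> R) : R :=
  \big[Num.max/0]_(i < M) \big[Num.max/0]_(j < M | j != i)
     enorm (fun k => mus i k - mus j k).
Definition Rmin (M d : nat) (mus : 'I_M -> 'I_d -> R) : R :=
  \big[Num.min/Rmax mus]_(i < M) \big[Num.min/Rmax mus]_(j < M | j != i)
     enorm (fun k => mus i k - mus j k).

Definition pimax (M : nat) (pi : 'I_M -> R) : R := \big[Num.max/0]_(i < M) pi i.
Definition pimin (M : nat) (pi : 'I_M -> R) : R := \big[Num.min/1]_(i < M) pi i.
Definition kappa (M : nat) (pi : 'I_M -> R) : R := pimax pi / pimin pi.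

(* gmm is the law GMM(pi, mus, I_d) on R^d = d.-tuple R: it is determined by
   its values on measurable rectangles, where it equals
   sum_i pi_i prod_k N((mus i) k, 1)(B k)  (integral of sum_i pi_i phi(.|mus i)) *)
Definition is_GMM_law (M d : nat) (pi : 'I_M -> R) (mus : 'I_M -> 'I_d -> R)
    (gmm : probability (d.-tuple R) R) : Prop :=
  forall B : 'I_d -> set R, (forall k, measurable (B k)) ->
    gmm [set x : d.-tuple R | forall k, B k (tnth x k)] =
    (\sum_(i < M) (pi i)%:E * \prod_(k < d) normal_prob (mus i k) 1 (B k))%E.

Definition Gpop (M d : nat) (pi : 'I_M -> R) (gmm : probability (d.-tuple R) R)
    (i : 'I_M) (mu : 'I_M -> 'I_d -> R) : 'I_d -> R :=
  fun k => Rintegral gmm setT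
    (fun x : d.-tuple R => wgt pi i (tnth x) mu * (tnth x k - mu i k)).

Definition Gemp (M d n : nat) (pi : 'I_M -> R) (xs : 'I_n -> d.-tuple R)
    (i : 'I_M) (mu : 'I_M -> 'I_d -> R) : 'I_d -> R :=
  fun k => n%:R^-1 * \sum_(j < n) wgt pi i (tnth (xs j)) mu * (tnth (xs j) k - mu i k).

Definition mutually_independent (dO : measure_display) (O : measurableType dO)
    (P : probability O R) (d n : nat) (X : 'I_n -> O -> d.-tuple R) : Prop :=
  forall A : 'I_n -> set (d.-tuple R), (forall j, measurable (A j)) ->
    P [set w | forall j, A j (X j w)] = (\prod_(j < n) P (X j @^-1` A j))%E.

Definition ballsA (M d : nat) (mus : 'I_M -> 'I_d -> R) (a : R) :
    set ('I_M -> 'I_d -> R) :=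
  [set mu | forall i, enorm (fun k => mu i k - mus i k) <= a].

Definition eps_unif (c : R) (M d n : nat) (pi : 'I_M -> R)
    (mus : 'I_M -> 'I_d -> R) : R :=
  c * (M%:R * Num.sqrt M%:R) * (1 + 3 * Rmax mus) ^+ 3
    * Num.max 1 (ln (kappa pi)) * Num.sqrt (d%:R * ln n%:R / n%:R).

End GMM.

(* Main.v *)
Require Import Defs.
From HB Require Import structures.
From mathcomp Require Import all_boot all_order all_algebra.
From mathcomp Require Import all_classical all_reals all_analysis.
From mathcomp Require Import measurable_realfun ring lra finmap.
Set Implicit Arguments. Unset Strict Implicit. Unset Printing Implicit Defensive.
Import Order.TTheory GRing.Theory Num.Theory.
Import numFieldNormedType.Exports.
Local Open Scope classical_set_scope.
Local Open Scope ring_scope.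

(* Writing [K = 1 + Rmax], the only facts used about the mixture law are the
   moment bound [E exp <v, X> <= exp (K |v| + |v| ^ 2 / 2)] and [|mu_i| <= 2 K]
   on the parameter set, as [a <= Rmin / 2 <= Rmax / 2]. A weighted
   displacement [w (X) (X - m)] with [0 <= w <= 1] is then, once centered, sub-
   Gaussian of scale [K] in every direction. Averaging exponential moments over
   a Gaussian direction turns directional bounds into bounds on Euclidean norms
   without a net of the sphere. When [d <= n] a union bound over a net of
   parameters of mesh [n ^ -4], combined with a Lipschitz estimate in [mu],
   gives the uniform bound. When [n < d] such a net costs [d log d] instead of
   [d log n]; there the sums [sum_j t_j X_j] are bounded uniformly over all
   weights [t_j] in [0, 1], which ignores their dependence on [mu] altogether. *)

(** * Integrals of products of independent factors *)

(** The obstacle is that [mu] enters only through the weights, so neither the supremum nor its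
    measurability is directly accessible. Every probabilistic estimate therefore starts from one
    nonnegative function of the sample dominating all the exponentials at issue: a sum over a finite
    family, which contains the union bound, or [\prod_j (1 + expR <v, X_j>)], which dominates
    [expR (\sum_j t_j <v, X_j>)] for all weights at once. Markov's inequality for its Gaussian
    average yields a single measurable event, and such an event inside the good set is what the
    conclusion asks for. When [n < d] no cancellation between [Gpop] and [Gemp] is exploited: the
    rate is at least [1/2], so each can be bounded separately. When [d <= n] the logarithm of the
    net size would contain [ln K]; it is estimated by [2 * K * ln n]. This costs a power of [K] but
    keeps the rate free of [ln K], and the resulting scale [sqrt M * K ^+ 2] still fits below
    [M * sqrt M * (1 + 3 * Rmax) ^+ 3]. *)

Section weighted_comp.
Import HBNNSimple.
Local Open Scope ereal_scope.
Context d1 d2 (O : measurableType d1) (T : measurableType d2) (R : realType).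
Variables (P : {measure set O -> \bar R}) (Y : O -> T) (h : O -> R).
Hypothesis mY : measurable_fun setT Y.
Hypothesis mh : measurable_fun setT h.
Hypothesis h0 : forall w, (0 <= h w)%R.
Variables (I : finType) (c : I -> R) (nu : I -> {measure set T -> \bar R}).
Hypothesis c0 : forall i, (0 <= c i)%R.
Hypothesis PE : forall A, measurable A ->
  \int[P]_w (\1_A (Y w) * h w)%:E = \sum_i (c i)%:E * nu i A.

Let nnsfun_weighted_comp (f : {nnsfun T >-> R}) :
  \int[P]_w (f (Y w) * h w)%:E = \sum_i (c i)%:E * \int[nu i]_x (f x)%:E.
Proof.
have mfA r : measurable (f @^-1` [set r]) by exact: measurable_funPTI.
pose F := fset_set (range f).
have fE x : (f x)%:E = \sum_(r <- F) r%:E * (\1_(f @^-1` [set r]) x)%:E.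
  by rewrite fimfunE -fsumEFin// fsbig_finite//=.
have f0 r x : 0 <= r%:E * (\1_(f @^-1` [set r]) x)%:E :> \bar R.
  exact: nnfun_muleindic_ge0.
have mI r : measurable_fun setT (fun w => (\1_(f @^-1` [set r]) (Y w) * h w)%:E).
  apply/measurable_EFinP/measurable_funM => //.
  exact: measurableT_comp.
under eq_integral => w _.
  rewrite EFinM fE ge0_sume_distrl; last by move=> r _; exact: f0.
  under eq_bigr do rewrite -muleA -[X in _ * X]EFinM.
  over.
rewrite ge0_integral_sum//=; last 2 first.
- by move=> r; exact: (measurable_funeM r%:E (mI r)).
- by move=> r x _ /=; rewrite [X in _ * X]EFinM muleA mule_ge0// lee_fin.
transitivity (\sum_(r <- F) \sum_i (c i)%:E * (r%:E * nu i (f @^-1` [set r]))).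
  rewrite !big_seq; apply: eq_bigr => r rF.
  have r0 : (0 <= r)%R.
    by move: rF; rewrite in_fset_set// => /set_mem -[x _ <-].
  rewrite ge0_integralZl//=; last by move=> x _; rewrite lee_fin mulr_ge0.
  rewrite PE// ge0_sume_distrr; last first.
    by move=> i _; rewrite mule_ge0// lee_fin.
  by apply: eq_bigr => i _; rewrite muleCA.
rewrite exchange_big/=; apply: eq_bigr => i _.
rewrite integralT_nnsfun sintegralE fsbig_finite//= ge0_sume_distrr//.
by move=> r _; apply: (mulemu_ge0 (fun r => f @^-1` [set r])) => r0; exact: preimage_nnfun0.
Qed.

(** Linearity extends the hypothesis from indicators to simple functions, monotone convergence to
    the rest. The weight [h] allows all but one factor of a product to be frozen, the finite family
    [nu] accommodates mixtures, and with [Y = id] and [h] a density this is a change of measure. *)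
Lemma ge0_integral_weighted_comp (f : T -> R) :
  measurable_fun setT f -> (forall x, 0 <= f x)%R ->
  \int[P]_w (f (Y w) * h w)%:E = \sum_i (c i)%:E * \int[nu i]_x (f x)%:E.
Proof.
move=> mf f0; have mf' : measurable_fun setT (EFin \o f) by exact/measurable_EFinP.
pose g := nnsfun_approx measurableT mf'.
have gf x : (g n x)%:E @[n --> \oo] --> (f x)%:E.
  by apply: cvg_nnsfun_approx => // y _; rewrite lee_fin.
have ndg x m n : (m <= n)%N -> (g m x <= g n x)%R.
  by move=> mn; exact/lefP/nd_nnsfun_approx.
have mg n : measurable_fun setT (g n) by [].
have lhs : \int[P]_w (g n (Y w) * h w)%:E @[n --> \oo] -->
           \int[P]_w (f (Y w) * h w)%:E.
  rewrite (_ : \int[P]_w (f (Y w) * h w)%:E =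
      \int[P]_w limn (fun n => (g n (Y w) * h w)%:E)).
    apply: cvg_monotone_convergence => //.
    - move=> n; apply/measurable_EFinP/measurable_funM => //.
      exact: (measurableT_comp (mg n)).
    - by move=> n w _; rewrite lee_fin mulr_ge0.
    - by move=> w _ m n mn; rewrite lee_fin ler_wpM2r// ndg.
  apply: eq_integral => w _; apply/esym/cvg_lim => //.
  rewrite EFinM; under eq_fun do rewrite EFinM.
  by apply: cvgeZr => //; exact: gf.
have rhs : \sum_i (c i)%:E * \int[nu i]_x (g n x)%:E @[n --> \oo] -->
           \sum_i (c i)%:E * \int[nu i]_x (f x)%:E.
  apply: cvg_nnesum => i _.
    apply: nearW => n; rewrite mule_ge0// ?lee_fin// integral_ge0// => x _.
    by rewrite lee_fin.
  apply: cvgeZl => //.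
  rewrite (_ : \int[nu i]_x (f x)%:E = \int[nu i]_x limn (fun n => (g n x)%:E)).
    apply: cvg_monotone_convergence => //.
    - by move=> n; exact/measurable_EFinP.
    - by move=> n x _; rewrite lee_fin.
    - by move=> x _ m n mn; rewrite lee_fin ndg.
  by apply: eq_integral => x _; apply/esym/cvg_lim => //; exact: gf.
have lhs' : \sum_i (c i)%:E * \int[nu i]_x (g n x)%:E @[n --> \oo] -->
            \int[P]_w (f (Y w) * h w)%:E.
  by under eq_cvg do rewrite -nnsfun_weighted_comp.
exact: (cvg_unique _ lhs' rhs).
Qed.

End weighted_comp.

Section product_law.
Local Open Scope ereal_scope.
Context d1 d2 (O : measurableType d1) (T : measurableType d2) (R : realType).
Variables (P : {measure set O -> \bar R}) (n : nat) (Y : 'I_n -> O -> T).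
Hypothesis mY : forall k, measurable_fun setT (Y k).
Variables (I : finType) (p : I -> R) (nu : I -> 'I_n -> probability T R).
Hypothesis p0 : forall i, (0 <= p i)%R.
Hypothesis rectE : forall B : 'I_n -> set T, (forall k, measurable (B k)) ->
  P [set w | forall k, B k (Y k w)] =
  \sum_i (p i)%:E * \prod_k nu i k (B k).

(** Serves both laws at hand: the mixture of products for one observation and, with [I = unit],
    independence across the sample. As only values on rectangles are given, the factors are freed
    one at a time. *)
Lemma integral_prod_rect (f : 'I_n -> T -> R) (e : I -> 'I_n -> R) :
  (forall k, measurable_fun setT (f k)) -> (forall k x, 0 <= f k x)%R ->
  (forall i k, \int[nu i k]_x (f k x)%:E = (e i k)%:E) ->
  \int[P]_w (\prod_k f k (Y k w))%:E = (\sum_i p i * \prod_k e i k)%:E.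
Proof.
(* Induction on the number [m] of leading factors that may be arbitrary. The others are indicators,
   so for [m = 0] the integrand is the indicator of a rectangle. *)
suff claim m : forall (f : 'I_n -> T -> R) (e : I -> 'I_n -> R),
  (forall k, measurable_fun setT (f k)) -> (forall k x, 0 <= f k x)%R ->
  (forall i k, \int[nu i k]_x (f k x)%:E = (e i k)%:E) ->
  (forall k : 'I_n, (m <= k)%N -> exists2 A, measurable A & f k = \1_A) ->
  \int[P]_w (\prod_k f k (Y k w))%:E = (\sum_i p i * \prod_k e i k)%:E.
  move=> mf f0 fe; apply: (claim n) => // k.
  by rewrite leqNgt ltn_ord.
elim: m => [|m IH] {}f {}e mf f0 fe find.
  have /choice [A HA] : forall k, exists A, measurable A /\ f k = \1_A.
    by move=> k; have [A mA fA] := find k isT; exists A.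
  have mA k : measurable (A k) by have [] := HA k.
  have mE : measurable [set w | forall k, A k (Y k w)].
    rewrite (_ : mkset _ = \bigcap_(k in [set: 'I_n]) (Y k @^-1` A k)).
      apply: fin_bigcap_measurable => // k _; rewrite -[X in measurable X]setTI.
      exact: mY.
    by apply/seteqP; split => w /= H k; [move=> _|]; apply: H.
  transitivity (\int[P]_w (\1_[set w | forall k, A k (Y k w)] w)%:E).
    apply: eq_integral => w _; congr EFin; rewrite indicE.
    have [Aw|/negP nAw] := boolP (w \in _).
      apply: big1 => k _; have [_ ->] := HA k.
      by rewrite indicE mem_set//; exact: (set_mem Aw).
    have [k nk] : exists k, ~ A k (Y k w).
      by apply/existsNP => H; apply: nAw; apply/mem_set.
    rewrite (bigD1 k)//=; have [_ ->] := HA k.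
    by rewrite indicE memNset// mul0r.
  rewrite integral_indic// setIT rectE// -sumEFin; apply: eq_bigr => i _.
  rewrite EFinM -prodEFin; congr (_ * _); apply: eq_bigr => k _.
  by rewrite -fe; have [_ ->] := HA k; rewrite integral_indic// setIT.
have [nm|mn] := leqP n m.
  by apply: IH => // k mk; have := leq_trans nm mk; rewrite leqNgt ltn_ord.
pose k0 := Ordinal mn.
have mprod : measurable_fun setT (fun w => \prod_(k | k != k0) f k (Y k w))%R.
  under eq_fun do rewrite -big_filter.
  by apply: measurable_prod => k _; exact: (measurableT_comp (mf k) (mY k)).
have c0 i : (0 <= p i * \prod_(k | k != k0) e i k)%R.
  rewrite mulr_ge0//; apply: prodr_ge0 => k _; rewrite -lee_fin -fe.
  by apply: integral_ge0 => x _; rewrite lee_fin.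
have -> : \int[P]_w (\prod_k f k (Y k w))%:E =
    \int[P]_w (f k0 (Y k0 w) * \prod_(k | k != k0) f k (Y k w))%:E.
  by apply: eq_integral => w _; rewrite (bigD1 k0).
rewrite (@ge0_integral_weighted_comp _ _ _ _ _ _ _ _ (mY k0) mprod _ _
    (fun i => p i * \prod_(k | k != k0) e i k)%R (fun i => nu i k0))//.
- rewrite -sumEFin; apply: eq_bigr => i _.
  by rewrite fe -EFinM [in RHS](bigD1 k0)//= mulrA mulrAC.
- by move=> w; exact: prodr_ge0.
(* With [\1_A] in place of factor [k0], the weighted law is the induction hypothesis. *)
- move=> A mA.
  pose f' k := if k == k0 then \1_A else f k.
  pose e' i k := if k == k0 then fine (nu i k0 A) else e i k.
  have := IH f' e'; rewrite /f' /e' => {}IH.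
  transitivity (\int[P]_w (\prod_k f' k (Y k w))%:E).
    apply: eq_integral => w _; rewrite [in RHS](bigD1 k0)//= /f' eqxx.
    by congr (_ * _)%:E; apply: eq_bigr => k /negbTE ->.
  rewrite IH.
  + rewrite -sumEFin; apply: eq_bigr => i _; rewrite (bigD1 k0)//= eqxx.
    rewrite -[X in _ = _ * X]fineK ?fin_num_measure// -EFinM.
    rewrite mulrAC -mulrA; congr (_ * (_ * _))%:E.
    by apply: eq_bigr => k /negbTE ->.
  + by move=> k; case: ifP.
  + by move=> k x; case: ifP => // _; rewrite indicE.
  + move=> i k; case: ifP => // /eqP ->.
    by rewrite integral_indic// setIT fineK// fin_num_measure.
  + move=> k mk; case: ifP => [_|kk0]; first by exists A.
    apply: find; rewrite ltn_neqAle mk andbT.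
    by apply: contraFN kk0 => /eqP mk'; apply/eqP/val_inj.
Qed.

End product_law.

(** * Gaussian integrals *)

Section normal_integrals.
Variable R : realType.
Implicit Types (m s t : R).

Lemma ge0_integral_normal_prob m s (f : R -> R) :
  measurable_fun setT f -> (forall x, 0 <= f x) ->
  (\int[normal_prob m s]_x (f x)%:E =
   \int[lebesgue_measure]_x (f x * normal_pdf m s x)%:E)%E.
Proof.
move=> mf f0; apply/esym.
rewrite (@ge0_integral_weighted_comp _ _ _ _ _ lebesgue_measure id
    (normal_pdf m s) _ _ _ unit (fun=> 1) (fun=> normal_prob m s))//.
- by rewrite big_const/= card_unit/= adde0 mul1e.
- exact: measurable_normal_pdf.
- by move=> x; exact: normal_pdf_ge0.
- move=> A mA; rewrite big_const/= card_unit/= adde0 mul1e /normal_prob.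
  rewrite [in RHS]integral_mkcond; apply: eq_integral => x _.
  by rewrite patchE indicE; case: ifP => _; rewrite ?mul1r ?mul0r.
Qed.

Lemma normal_pdf1E m (x : R) :
  normal_pdf m 1 x = normal_peak 1 * expR (- (x - m) ^+ 2 / 2).
Proof. by rewrite normal_pdfE ?oner_eq0// /normal_fun expr1n. Qed.

(** Completing the square: tilting the density by [expR (t * x)] shifts its mean to [m + t]. *)
Lemma normal_mgf m t :
  (\int[normal_prob m 1]_x (expR (t * x))%:E =
   (expR (t * m + t ^+ 2 / 2))%:E)%E.
Proof.
rewrite ge0_integral_normal_prob; last 2 first.
- by apply: measurableT_comp => //; exact: measurable_funM.
- by move=> x; exact: expR_ge0.
transitivity (\int[lebesgue_measure]_x
    ((expR (t * m + t ^+ 2 / 2))%:E * (normal_pdf (m + t) 1 x)%:E))%E.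
  apply: eq_integral => x _; rewrite -EFinM !normal_pdf1E; congr EFin.
  rewrite mulrCA [RHS]mulrCA -!expRD; congr (_ * expR _); by field.
rewrite (@ge0_integralZl _ _ _ lebesgue_measure _ measurableT
  (EFin \o normal_pdf (m + t) 1))//=.
- by rewrite integral_normal_pdf mule1.
- by apply/measurable_EFinP; exact: measurable_normal_pdf.
- by move=> x _; rewrite lee_fin normal_pdf_ge0.
Qed.

(* [expR (x ^+ 2 / 4)] times the standard normal density is [sqrt 2] times the
   centered normal density of variance 2. *)
Lemma integral_expR_sqr_normal_prob :
  (\int[normal_prob 0 1]_x (expR (x ^+ 2 / 4))%:E = (Num.sqrt 2 : R)%:E)%E.
Proof.
rewrite ge0_integral_normal_prob; last 2 first.
- by apply: measurableT_comp => //; exact: measurable_funM.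
- by move=> x; exact: expR_ge0.
have s2 : Num.sqrt 2 != 0 :> R by rewrite gt_eqF// sqrtr_gt0.
have s22 : Num.sqrt 2 ^+ 2 = 2 :> R by rewrite sqr_sqrtr.
transitivity (\int[lebesgue_measure]_x
    ((Num.sqrt 2 : R)%:E * (normal_pdf 0 (Num.sqrt 2) x)%:E))%E.
  apply: eq_integral => x _; rewrite -EFinM normal_pdf1E normal_pdfE//.
  congr EFin; rewrite /normal_fun s22 mulrCA -expRD mulrA; congr (_ * expR _).
    by rewrite /normal_peak s22 expr1n mul1r -mulrnAr sqrtrM// invfM mulVKf.
  by field.
rewrite (@ge0_integralZl _ _ _ lebesgue_measure _ measurableT
  (EFin \o normal_pdf 0 (Num.sqrt 2)))//=.
- by rewrite integral_normal_pdf mule1.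
- by apply/measurable_EFinP; exact: measurable_normal_pdf.
- by move=> x _; rewrite lee_fin normal_pdf_ge0.
Qed.

End normal_integrals.

(** * From directional exponential moments to norms *)

(* Hubbard--Stratonovich: averaging [exp (<v, s>)] over a Gaussian vector [v]
   gives [exp (|s| ^ 2 / (8 B))], so a pointwise-in-[v] moment bound becomes a
   moment bound uniform over all [s] whose exponentials [F] dominates. *)
Lemma gaussian_average d0 (O : measurableType d0) (R : realType)
    (P : probability O R) (B : R) (d : nat) (F : d.-tuple R * O -> \bar R)
    (A : R) :
  0 < B -> 0 <= A -> measurable_fun setT F -> (forall z, 0 <= F z)%E ->
  (forall v : d.-tuple R, \int[P]_w F (v, w) <=
     (A * expR (B * \sum_k tnth v k ^+ 2))%:E)%E ->
  exists H : O -> \bar R, [/\ measurable_fun setT H, forall w, (0 <= H w)%E,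
    (\int[P]_w H w <= (A * Num.sqrt 2 ^+ d)%:E)%E &
    forall w (s : 'I_d -> R) (a : R), 0 <= a ->
      (forall v : d.-tuple R,
         ((a * expR (\sum_k tnth v k * s k))%:E <= F (v, w))%E) ->
      ((a * expR ((\sum_k s k ^+ 2) / (8 * B)))%:E <= H w)%E].
Proof.
move=> B0; elim: d F A => [|d IH] F A A0 mF F0 FA.
  exists (fun w => F ([tuple], w)); split => //.
  - by apply: measurableT_comp => //; exact: measurable_pair1.
  - by have := FA [tuple]; rewrite big_ord0 mulr0 expR0 expr0.
  - move=> w s a a0 /(_ [tuple]); rewrite big_ord0 => h.
    by rewrite big_ord0 mul0r.
(* Standard deviation of the averaging variable [c * g]. It turns [expR (B * (c * g) ^+ 2)] into
   [expR (g ^+ 2 / 4)], still integrable under the normal law, and gives the exponent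
   [c ^+ 2 / 2 = (8 * B)^-1]. *)
pose c : R := (Num.sqrt (4 * B))^-1.
have c2 : c ^+ 2 = (4 * B)^-1 by rewrite exprVn sqr_sqrtr// mulr_ge0// ltW.
have B0' : B != 0 by rewrite gt_eqF.
pose F1 (z : R * (d.-tuple R * O)) := F ([tuple of c * z.1 :: z.2.1], z.2.2).
have mF1 : measurable_fun setT F1.
  apply: (measurableT_comp mF); apply: measurable_fun_pair => /=.
    apply: measurable_cons.
      exact: measurable_funM.
    exact: (measurableT_comp measurable_fst measurable_snd).
  exact: (measurableT_comp measurable_snd measurable_snd).
pose F' (y : d.-tuple R * O) := (\int[normal_prob 0 1]_g F1 (g, y))%E.
have mF' : measurable_fun setT F'.
  by apply: measurable_fun_fubini_tonelli_G => // z; exact: F0.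
have F'0 y : (0 <= F' y)%E by apply: integral_ge0 => g _; exact: F0.
have s20 : 0 <= Num.sqrt 2 :> R by exact: sqrtr_ge0.
have F'A (v : d.-tuple R) : (\int[P]_w F' (v, w) <=
    (A * Num.sqrt 2 * expR (B * \sum_k tnth v k ^+ 2))%:E)%E.
  pose f (z : R * O) := F1 (z.1, (v, z.2)).
  have mf : measurable_fun setT f.
    apply: (measurableT_comp mF1); apply: measurable_fun_pair => //=.
    by apply: measurable_fun_pair.
  have -> : (\int[P]_w F' (v, w) =
      \int[normal_prob 0 1]_g \int[P]_w f (g, w))%E.
    by rewrite fubini_tonelli// => z; exact: F0.
  apply: (@le_trans _ _ (\int[normal_prob 0 1]_g
      ((A * expR (B * \sum_k tnth v k ^+ 2))%:E * (expR (g ^+ 2 / 4))%:E))%E).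
    apply: ge0_le_integral => //.
    - by move=> g _; apply: integral_ge0 => w _; exact: F0.
    - by apply: measurable_fun_fubini_tonelli_F => // z; exact: F0.
    - apply: measurable_funeM; apply/measurable_EFinP.
      by apply: measurableT_comp => //; exact: measurable_funM.
    - move=> g _; apply: (le_trans (FA [tuple of c * g :: v])).
      rewrite -EFinM lee_fin -mulrA ler_wpM2l// -expRD ler_expR.
      have -> : g ^+ 2 / 4 = B * (c * g) ^+ 2 by rewrite exprMn c2; field.
      rewrite big_ord_recl/= tnth0 mulrDr addrC lerD2r ler_wpM2l ?(ltW B0)//.
      by apply: ler_sum => k _; rewrite tnthS.
  rewrite ge0_integralZl//=.
  - by rewrite integral_expR_sqr_normal_prob -EFinM lee_fin mulrAC.
  - apply/measurable_EFinP.
    by apply: measurableT_comp => //; exact: measurable_funM.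
  - by rewrite lee_fin mulr_ge0// expR_ge0.
have [H [mH H0 HA Hs]] := IH F' _ (mulr_ge0 A0 s20) mF' F'0 F'A.
exists H; split => //; first by rewrite exprS mulrA.
move=> w s a a0 aF.
(* The first coordinate's factor is absorbed into [a]; this is why the claim carries a prefactor. *)
rewrite big_ord_recl mulrDl expRD mulrA.
apply: (Hs w (fun k => s (lift ord0 k)) (a * expR (s ord0 ^+ 2 / (8 * B)))).
  by rewrite mulr_ge0// expR_ge0.
move=> v.
(* The standard normal moment generating function at [c * s ord0], read backwards. *)
have -> : expR (s ord0 ^+ 2 / (8 * B)) =
    expR ((c * s ord0) * 0 + (c * s ord0) ^+ 2 / 2).
  by congr expR; rewrite mulr0 add0r exprMn c2; field.
rewrite mulrAC EFinM -normal_mgf -ge0_integralZl//=.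
- apply: ge0_le_integral => //.
  + by move=> g _; rewrite -EFinM lee_fin !mulr_ge0// expR_ge0.
  + by apply: measurable_funeM; apply/measurable_EFinP; apply: measurableT_comp.
  + by apply: (measurableT_comp mF1); exact: measurable_pair2.
  + move=> g _; apply: le_trans (aF [tuple of c * g :: v]).
    rewrite -EFinM lee_fin -[_ * _ * expR _]mulrA ler_wpM2l// -expRD ler_expR.
    rewrite [leRHS]big_ord_recl/= tnth0 addrC mulrAC lerD2l.
    by apply: ler_sum => k _; rewrite tnthS.
- by apply/measurable_EFinP; apply: measurableT_comp.
- by rewrite lee_fin mulr_ge0// expR_ge0.
Qed.

(** Markov's inequality for [H] at level [expR lam]. The event is fixed before [s], so it serves
    every [s] whose exponentials [F] dominates. *)
Lemma gaussian_average_tail d0 (O : measurableType d0) (R : realType)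
    (P : probability O R) (B : R) (d : nat) (F : d.-tuple R * O -> \bar R)
    (A lam : R) :
  0 < B -> 0 <= A -> measurable_fun setT F -> (forall z, 0 <= F z)%E ->
  (forall v : d.-tuple R, \int[P]_w F (v, w) <=
     (A * expR (B * \sum_k tnth v k ^+ 2))%:E)%E ->
  exists E : set O, [/\ measurable E,
    ((1 - A * 2 ^+ d * expR (- lam))%:E <= P E)%E &
    forall w (s : 'I_d -> R), E w ->
      (forall v : d.-tuple R,
         ((expR (\sum_k tnth v k * s k))%:E <= F (v, w))%E) ->
      \sum_k s k ^+ 2 <= 8 * B * lam].
Proof.
move=> B0 A0 mF F0 FA.
have [H [mH H0 HA Hs]] := gaussian_average B0 A0 mF F0 FA.
pose N : set O := [set w | ((expR lam)%:E <= H w)%E].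
have mN : measurable N.
  by rewrite /N -[X in measurable X]setTI; exact: emeasurable_fun_c_infty.
have NE : N = [set w | ((expR lam)%:E <= `|H w|)%E].
  by apply/seteqP; split => w /=; rewrite gee0_abs.
have PN : ((expR lam)%:E * P N <= (A * Num.sqrt 2 ^+ d)%:E)%E.
  apply: le_trans HA; have := @le_integral_abse _ _ _ P setT measurableT H
    (expR lam) mH (expR_gt0 _).
  rewrite setTI -NE => /le_trans; apply.
  by rewrite (eq_integral H)// => w _; rewrite gee0_abs.
have s2 : Num.sqrt 2 <= 2 :> R.
  rewrite -[leRHS](@ger0_norm _ 2)// -sqrtr_sqr ler_wsqrtr//; lra.
have {}PN : (P N <= (A * 2 ^+ d * expR (- lam))%:E)%E.
  rewrite mulrC EFinM expRN lee_pdivlMl ?expR_gt0//; apply: le_trans PN _.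
  by rewrite lee_fin ler_wpM2l// lerXn2r// nnegrE// sqrtr_ge0.
exists (~` N); split; first exact: measurableC.
  by rewrite probability_setC// EFinB leeB.
move=> w s /= /negP; rewrite -ltNge => HN sF.
have : ((expR ((\sum_k s k ^+ 2) / (8 * B)))%:E < (expR lam)%:E)%E.
  apply: le_lt_trans HN; rewrite -[expR _]mul1r; apply: Hs => // v.
  by rewrite mul1r.
rewrite lte_fin ltr_expR ltr_pdivrMr ?mulr_gt0// => /ltW.
by rewrite mulrC.
Qed.

(** Both signs follow from [1 + y <= expR y]. The linear term is kept because it integrates to zero
    after centering. *)
Lemma expR_le_quadratic (R : realType) (x : R) :
  expR x <= 1 + x + x ^+ 2 * expR `|x|.
Proof.
have ex1 : expR x - 1 <= x * expR x.
  have := ler_wpM2r (expR_ge0 x) (expR_ge1Dx (- x)).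
  by rewrite -expRD addNr expR0; lra.
have [x0|x0] := leP 0 x.
  rewrite ger0_norm//.
  have : x * (expR x - 1) <= x * (x * expR x) by rewrite ler_wpM2l.
  lra.
have ea : 1 <= expR `|x| by rewrite -[leLHS]expR0 ler_expR.
have h : 1 - expR x <= - x by have := expR_ge1Dx x; lra.
have : - x * (1 - expR x) <= - x * (- x) by rewrite ler_wpM2l//; lra.
have : x ^+ 2 * 1 <= x ^+ 2 * expR `|x| by rewrite ler_wpM2l// sqr_ge0.
lra.
Qed.

Lemma sqr_le_expR (R : realType) (x : R) : 0 <= x -> x ^+ 2 <= 2 * expR x.
Proof.
by move=> x0; have := @expR_ge1Dxn _ x 1 x0; rewrite !factS fact0; lra.
Qed.

Lemma expR_norm_le (R : realType) (x : R) : expR `|x| <= expR x + expR (- x).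
Proof.
by case: (ger0P x) => _; have := expR_ge0 x; have := expR_ge0 (- x); lra.
Qed.

(** * Centering a variable dominated by a sub-Gaussian one *)

Section subgaussian_centering.
Context d (T : measurableType d) (R : realType) (Q : probability T R).
Variables Y V : T -> R.
Hypotheses (mY : measurable_fun setT Y) (mV : measurable_fun setT V).
Hypothesis YV : forall x, `|Y x| <= `|V x|.
Hypothesis mgfV : forall t, (\int[Q]_x (expR (t * V x))%:E <=
  (expR (3 * `|t| + t ^+ 2 / 2))%:E)%E.

Let mexp t : measurable_fun setT (fun x => expR (t * V x)).
Proof. by apply: measurableT_comp => //; exact: measurable_funM. Qed.

Lemma integral_expR_norm t : (\int[Q]_x (expR (t * `|V x|))%:E <=
  (2 * expR (3 * `|t| + t ^+ 2 / 2))%:E)%E.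
Proof.
apply: (@le_trans _ _ (\int[Q]_x ((expR (t * V x))%:E + (expR (- t * V x))%:E))%E).
  apply: ge0_le_integral => //.
  - apply/measurable_EFinP; apply: measurableT_comp => //.
    by apply: measurable_funM => //; exact: measurableT_comp.
  - by apply: emeasurable_funD; apply/measurable_EFinP.
  - move=> x _; rewrite -EFinD lee_fin mulNr.
    have e1 := expR_ge0 (t * V x); have e2 := expR_ge0 (- (t * V x)).
    have [x0|x0] := leP 0 (V x); first by rewrite ger0_norm// lerDl.
    by rewrite ltr0_norm// mulrN lerDr.
rewrite ge0_integralD//=.
- by rewrite mulr_natl mulr2n EFinD leeD// (le_trans (mgfV _))// normrN sqrrN.
- by apply/measurable_EFinP.
- by apply/measurable_EFinP.
Qed.

(** Bounds the mean of [|V|], by [|V| <= expR |V|] and [integral_expR_norm] at [t = 1]. *)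
Definition subgaussian_mean : R := 2 * expR (3 + 2^-1).

Let normV_le x : `|V x| <= expR (1 * `|V x|).
Proof. by rewrite mul1r; have := expR_ge1Dx `|V x|; lra. Qed.

Let integral_normV : (\int[Q]_x (`|V x|)%:E <= subgaussian_mean%:E)%E.
Proof.
apply: (@le_trans _ _ (\int[Q]_x (expR (1 * `|V x|))%:E)%E).
  apply: ge0_le_integral => //.
  - by apply/measurable_EFinP; exact: measurableT_comp.
  - apply/measurable_EFinP; apply: measurableT_comp => //.
    by apply: measurable_funM => //; exact: measurableT_comp.
  - by move=> x _; rewrite lee_fin.
apply: le_trans (integral_expR_norm 1) _.
by rewrite normr1 expr1n mulr1 mul1r.
Qed.

Let integral_normY : (\int[Q]_x (`|Y x|)%:E <= subgaussian_mean%:E)%E.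
Proof.
apply: le_trans integral_normV; apply: ge0_le_integral => //.
- by apply/measurable_EFinP; exact: measurableT_comp.
- by apply/measurable_EFinP; exact: measurableT_comp.
- by move=> x _; rewrite lee_fin.
Qed.

Lemma subgaussian_integrable : Q.-integrable setT (EFin \o Y).
Proof.
apply/integrableP; split; first by apply/measurable_EFinP.
exact: le_lt_trans integral_normY (ltry _).
Qed.

Lemma subgaussian_mean_le : `|\int[Q]_x Y x| <= subgaussian_mean.
Proof.
rewrite -lee_fin (le_trans _ integral_normY)// EFin_normr_Rintegral//=.
  exact: le_abse_integral (measurable_int _ subgaussian_integrable).
exact: subgaussian_integrable.
Qed.

(** With [c] the mean bound, the expansion for [|s| <= 1] gives [4 * expR (2 * c + 8)]; for
    [|s| > 1] the exponent [|s| * c + 1 + 3 * |s| + s ^+ 2 / 2] is at most [(c + 5) * s ^+ 2]. *)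
Definition subgaussian_variance : R :=
  4 * expR (2 * subgaussian_mean + 8) + subgaussian_mean + 5.

(** For [|s| > 1] the growth is imported from [V], linear terms in [|s|] being at most quadratic.
    For [|s| <= 1] the linear term must cancel, which is where the mean is used. *)
Lemma subgaussian_centered_mgf s :
  (\int[Q]_x (expR (s * (Y x - \int[Q]_x Y x)))%:E <=
   (expR (subgaussian_variance * s ^+ 2))%:E)%E.
Proof.
set m := \int[Q]_x Y x; set c := subgaussian_mean.
have mc : `|m| <= c by exact: subgaussian_mean_le.
have c0 : 0 <= c by exact: le_trans mc.
have YmV x : `|Y x - m| <= `|V x| + c.
  by rewrite (le_trans (ler_normB _ _))// lerD.
have mexpn t : measurable_fun setT (fun x => expR (t * `|V x|)).
  apply: measurableT_comp => //; apply: measurable_funM => //.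
  exact: measurableT_comp.
have mYm : measurable_fun setT (fun x => Y x - m) by exact: measurable_funB.
have mlhs : measurable_fun setT (fun x => expR (s * (Y x - m))).
  by apply: measurableT_comp => //; exact: measurable_funM.
have [s1|s1] := leP `|s| 1; last first.
  apply: (@le_trans _ _ (\int[Q]_x
      ((expR (`|s| * c))%:E * (expR (`|s| * `|V x|))%:E))%E).
    apply: ge0_le_integral => //.
    - by apply/measurable_EFinP.
    - by apply: measurable_funeM; apply/measurable_EFinP.
    - move=> x _; rewrite -EFinM lee_fin -expRD ler_expR.
      rewrite (le_trans (ler_norm _))// normrM -mulrDr.
      by rewrite ler_wpM2l// [leRHS]addrC; exact: YmV.
  rewrite ge0_integralZl//=; last by apply/measurable_EFinP.
  apply: (@le_trans _ _ ((expR (`|s| * c))%:E *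
      (2 * expR (3 * `|s| + s ^+ 2 / 2))%:E)%E).
    rewrite lee_wpmul2l ?lee_fin ?expR_ge0//.
    by have := integral_expR_norm `|s|; rewrite normr_id real_normK ?num_real.
  rewrite -EFinM lee_fin; have e2 : 2 <= expR (1 : R).
    by have := expR_ge1Dx (1 : R); lra.
  apply: (@le_trans _ _ (expR (`|s| * c) * (expR 1 * expR (3 * `|s| + s ^+ 2 / 2)))).
    by rewrite ler_wpM2l ?expR_ge0// ler_wpM2r ?expR_ge0.
  rewrite -!expRD ler_expR /subgaussian_variance -/c.
  have ss : `|s| <= s ^+ 2 by rewrite -real_normK ?num_real// expr2 ler_peMl// ltW.
  have ss1 : 1 <= s ^+ 2 by rewrite (le_trans _ ss)// ltW.
  have : `|s| * c <= s ^+ 2 * c by rewrite ler_wpM2r.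
  have : 0 <= s ^+ 2 * expR (2 * c + 8) by rewrite mulr_ge0// ?expR_ge0// sqr_ge0.
  lra.
have EV : (\int[Q]_x (expR (2 * `|V x|))%:E <= (2 * expR 8)%:E)%E.
  apply: le_trans (integral_expR_norm 2) _.
  by rewrite lee_fin ger0_norm// (_ : 3 * 2 + 2 ^+ 2 / 2 = 8 :> R)//; lra.
(* With [z = Y x - m]: [z ^+ 2 <= 2 * expR |z|], [|s * z| <= |z|] and [|z| <= |V x| + c], which
   explains the exponent [2 * |V x|]. *)
have pt x : expR (s * (Y x - m)) <=
    1 + s * (Y x - m) + 2 * s ^+ 2 * expR (2 * c) * expR (2 * `|V x|).
  apply: le_trans (expR_le_quadratic _) _; rewrite lerD2l exprMn.
  set z := Y x - m; have z2 : z ^+ 2 <= 2 * expR `|z|.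
    by rewrite -real_normK ?num_real//; exact: sqr_le_expR.
  suff : z ^+ 2 * expR `|s * z| <= 2 * (expR (2 * c) * expR (2 * `|V x|)).
    by move=> /(ler_wpM2l (sqr_ge0 s)); lra.
  apply: (@le_trans _ _ (2 * expR `|z| * expR `|z|)).
    apply: ler_pM; rewrite ?sqr_ge0 ?expR_ge0// ler_expR normrM.
    by rewrite ler_piMl.
  rewrite -mulrA -!expRD ler_wpM2l// ler_expR.
  by have := YmV x; rewrite -/z; lra.
have iY : Q.-integrable setT (EFin \o Y) := subgaussian_integrable.
have iV : Q.-integrable setT (EFin \o (fun x => expR (2 * `|V x|))).
  apply/integrableP; split; first by apply/measurable_EFinP.
  under eq_integral do rewrite /= ger0_norm ?expR_ge0//.
  exact: le_lt_trans EV (ltry _).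
have i1 a : Q.-integrable setT (EFin \o cst a).
  by apply: finite_measure_integrable_cst.
have iYm : Q.-integrable setT (EFin \o (fun x => Y x - m)).
  by have := integrableB measurableT iY (i1 m).
have EYm : (\int[Q]_x (Y x - m)%:E = 0)%E.
  under eq_integral do rewrite EFinB.
  rewrite (integralB_EFin measurableT iY (i1 m))/= integral_cst//.
  rewrite [X in (_ * X)%E](@probability_setT _ _ _ Q) mule1.
  by rewrite -[X in (X - _)%E]fineK ?subee//; exact: integrable_fin_num.
set k := 2 * s ^+ 2 * expR (2 * c).
have k0 : 0 <= k by rewrite mulr_ge0 ?expR_ge0// mulr_ge0 ?sqr_ge0.
have ikV : Q.-integrable setT (EFin \o (fun x => k * expR (2 * `|V x|))).
  by have := integrableZl measurableT k iV.
have isYm : Q.-integrable setT (EFin \o (fun x => s * (Y x - m))).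
  by have := integrableZl measurableT s iYm.
have i1s : Q.-integrable setT (EFin \o (fun x => 1 + s * (Y x - m))).
  by have := integrableD measurableT (i1 1) isYm.
apply: (@le_trans _ _ (\int[Q]_x ((1 + s * (Y x - m))%:E +
    (k * expR (2 * `|V x|))%:E))%E).
  apply: ge0_le_integral => //.
  - by apply/measurable_EFinP.
  - by apply: emeasurable_funD; [exact: (measurable_int _ i1s)|
      exact: (measurable_int _ ikV)].
  - by move=> x _; rewrite -EFinD lee_fin.
rewrite (integralD measurableT i1s ikV)/=.
have -> : (\int[Q]_x (1 + s * (Y x - m))%:E = 1)%E.
  under eq_integral do rewrite EFinD.
  rewrite (integralD measurableT (i1 1) isYm)/= integral_cst//.
  rewrite [X in (_ * X)%E](@probability_setT _ _ _ Q) mule1.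
  under eq_integral do rewrite EFinM.
  by rewrite (integralZl measurableT iYm)/= EYm mule0 adde0.
under eq_integral do rewrite EFinM.
rewrite (integralZl measurableT iV)/=.
apply: (@le_trans _ _ (1 + k%:E * (2 * expR 8)%:E)%E).
  by rewrite leeD2l// lee_wpmul2l.
rewrite -EFinM -EFinD lee_fin; apply: le_trans (expR_ge1Dx _).
rewrite lerD2l /k /subgaussian_variance -/c [expR (2 * c + 8)]expRD.
have : 0 <= s ^+ 2 * c by rewrite mulr_ge0// sqr_ge0.
by have := sqr_ge0 s; lra.
Qed.

End subgaussian_centering.

(** * Euclidean norm and the mixture law *)

Section euclidean_norm.
Context (R : realType) (d : nat).
Implicit Types u v : 'I_d -> R.

Lemma enorm_ge0 v : 0 <= enorm v. Proof. exact: sqrtr_ge0. Qed.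

Lemma sumsq_ge0 v : 0 <= \sum_k v k ^+ 2.
Proof. by apply: sumr_ge0 => k _; exact: sqr_ge0. Qed.

Lemma enorm_sqr v : enorm v ^+ 2 = \sum_k v k ^+ 2.
Proof. by rewrite sqr_sqrtr// sumsq_ge0. Qed.

Lemma enorm_eq0 v : enorm v = 0 -> forall k, v k = 0.
Proof.
move=> v0 k; have /eqP := enorm_sqr v; rewrite v0 expr0n/= eq_sym psumr_eq0.
  by move=> /allP/(_ k); rewrite mem_index_enum sqrf_eq0 => /(_ isT)/eqP.
by move=> i _; exact: sqr_ge0.
Qed.

Lemma cauchy_schwarz_enorm u v : \sum_k u k * v k <= enorm u * enorm v.
Proof.
have [u0|u0] := eqVneq (enorm u) 0.
  by rewrite u0 mul0r big1// => k _; rewrite enorm_eq0// mul0r.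
have [v0|v0] := eqVneq (enorm v) 0.
  by rewrite v0 mulr0 big1// => k _; rewrite (enorm_eq0 v0)// mulr0.
set a := enorm u; set b := enorm v.
have ab0 : 0 < a * b by rewrite mulr_gt0 ?lt0r ?enorm_ge0 ?andbT.
have : 0 <= \sum_k (b * u k - a * v k) ^+ 2.
  by apply: sumr_ge0 => k _; exact: sqr_ge0.
have -> : \sum_k (b * u k - a * v k) ^+ 2 =
    b ^+ 2 * (\sum_k u k ^+ 2) + a ^+ 2 * (\sum_k v k ^+ 2)
    - 2 * (a * b) * \sum_k u k * v k.
  rewrite !mulr_sumr -big_split/= -sumrB; apply: eq_bigr => k _; ring.
rewrite -!enorm_sqr -/a -/b => h.
rewrite -(ler_pM2l ab0); lra.
Qed.

Lemma enormZ (c : R) v : enorm (fun k => c * v k) = `|c| * enorm v.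
Proof.
rewrite /enorm -sqrtr_sqr -sqrtrM ?sqr_ge0// mulr_sumr; congr Num.sqrt.
by apply: eq_bigr => k _; rewrite exprMn.
Qed.

Lemma enormN v : enorm (fun k => - v k) = enorm v.
Proof. by rewrite /enorm; under eq_bigr do rewrite sqrrN. Qed.

Lemma le_enormD u v : enorm (fun k => u k + v k) <= enorm u + enorm v.
Proof.
rewrite -(@ler_pXn2r _ 2)// ?nnegrE ?addr_ge0 ?enorm_ge0//.
rewrite sqrrD !enorm_sqr.
under eq_bigr do rewrite sqrrD.
rewrite !big_split/= lerD2r lerD2l.
by rewrite mulr2n lerD// cauchy_schwarz_enorm.
Qed.

Lemma le_enormB u v : enorm (fun k => u k - v k) <= enorm u + enorm v.
Proof. by rewrite -(enormN v); exact: le_enormD. Qed.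

Lemma le_coord_enorm v k : `|v k| <= enorm v.
Proof.
rewrite -sqrtr_sqr ler_wsqrtr// (bigD1 k)//= lerDl.
by apply: sumr_ge0 => i _; exact: sqr_ge0.
Qed.

Lemma enorm_le_coord v b : (forall k, `|v k| <= b) ->
  enorm v <= Num.sqrt d%:R * b.
Proof.
case: d v => [|n] v vb; first by rewrite /enorm big_ord0 sqrtr0 mul0r.
have b0 : 0 <= b by exact: le_trans (vb ord0).
rewrite -[b in leRHS]ger0_norm// -sqrtr_sqr -sqrtrM// ler_wsqrtr//.
rewrite -[n.+1 in leRHS]card_ord -sum1_card natr_sum mulr_suml.
by apply: ler_sum => k _; rewrite mul1r -real_normK ?num_real// lerXn2r ?nnegrE.
Qed.

End euclidean_norm.

(** Since the centers average to zero, [mus i] is the [pi]-average of the differences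
    [mus i - mus j]; pairing it with itself turns this into a norm bound. *)
Lemma enorm_mean_le (R : realType) M d (pi : 'I_M -> R) (mus : 'I_M -> 'I_d -> R) i :
  (forall i, 0 < pi i) -> \sum_i pi i = 1 ->
  (forall k, \sum_i pi i * mus i k = 0) -> enorm (mus i) <= Rmax mus.
Proof.
move=> pi0 pi1 mean0.
have R0 : 0 <= Rmax mus by exact: bigmax_ge_id.
have muR j : enorm (fun k => mus i k - mus j k) <= Rmax mus.
  have [->|ji] := eqVneq j i.
    by rewrite /enorm big1 ?sqrtr0// => k _; rewrite subrr expr0n.
  apply: le_trans (le_bigmax_cond _ _ _) => //.
  exact: (le_bigmax_cond _ (fun j => enorm (fun k => mus i k - mus j k))).
have h : enorm (mus i) ^+ 2 <= enorm (mus i) * Rmax mus.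
  rewrite enorm_sqr.
  have -> : \sum_k mus i k ^+ 2 =
      \sum_j pi j * \sum_k mus i k * (mus i k - mus j k).
    under [RHS]eq_bigr do rewrite mulr_sumr.
    rewrite exchange_big/=; apply: eq_bigr => k _.
    under eq_bigr do rewrite mulrCA.
    rewrite -mulr_sumr expr2; congr (_ * _).
    under eq_bigr do rewrite mulrBr.
    by rewrite sumrB mean0 subr0 -mulr_suml pi1 mul1r.
  rewrite -[leRHS]mul1r -pi1 mulr_suml; apply: ler_sum => j _.
  rewrite ler_wpM2l ?(ltW (pi0 j))// (le_trans (cauchy_schwarz_enorm _ _))//.
  by rewrite ler_wpM2l// enorm_ge0.
have [->//|n0] := eqVneq (enorm (mus i)) 0.
by move: h; rewrite expr2 ler_pM2l// lt0r n0 enorm_ge0.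
Qed.

Lemma gmm_mgf (R : realType) M d (pi : 'I_M -> R) (mus : 'I_M -> 'I_d -> R)
    (gmm : probability (d.-tuple R) R) (K : R) (v : 'I_d -> R) :
  (forall i, 0 < pi i) -> \sum_i pi i = 1 -> is_GMM_law pi mus gmm ->
  (forall i, enorm (mus i) <= K) ->
  (\int[gmm]_x (expR (\sum_k v k * tnth x k))%:E <=
   (expR (K * enorm v + enorm v ^+ 2 / 2))%:E)%E.
Proof.
move=> pi0 pi1 law muK.
under eq_integral do rewrite expR_sum.
rewrite (@integral_prod_rect _ _ _ (g_sigma_algebraType R.-ocitv.-measurable)
    _ gmm d (fun k x => tnth x k) _ _ pi
    (fun i k => normal_prob (mus i k) 1) _ _ (fun k x => expR (v k * x))
    (fun i k => expR (v k * mus i k + v k ^+ 2 / 2))).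
- rewrite lee_fin; set b := (X in _ <= X).
  have -> : b = \sum_i pi i * b by rewrite -mulr_suml pi1 mul1r.
  apply: ler_sum => i _; rewrite /b.
  rewrite ler_wpM2l ?(ltW (pi0 i))// -expR_sum ler_expR big_split/=.
  rewrite -mulr_suml -enorm_sqr lerD2r (le_trans (cauchy_schwarz_enorm _ _))//.
  by rewrite mulrC ler_wpM2r ?enorm_ge0.
- by move=> k; exact: measurable_tnth.
- by move=> i; exact: ltW.
- exact: law.
- by move=> k; apply: measurableT_comp => //; exact: measurable_funM.
- by move=> k x; exact: expR_ge0.
- by move=> i k; exact: normal_mgf.
Qed.

(** * Weighted displacements *)

Section weighted_displacement.
Context (R : realType) (d : nat) (Q : probability (d.-tuple R) R) (K : R).
Hypothesis K1 : 1 <= K.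
Hypothesis mgfQ : forall v : 'I_d -> R,
  (\int[Q]_x (expR (\sum_k v k * tnth x k))%:E <=
   (expR (K * enorm v + enorm v ^+ 2 / 2))%:E)%E.
Variables (w : d.-tuple R -> R) (m : 'I_d -> R).
Hypotheses (mw : measurable_fun setT w) (w0 : forall x, 0 <= w x).
Hypotheses (w1 : forall x, w x <= 1) (mK : enorm m <= 2 * K).

Implicit Types v : 'I_d -> R.
Local Notation f x k := (w x * (tnth x k - m k)).
Local Notation G k := (\int[Q]_x f x k).
(** The normalisation makes the moment bound universal, [expR (3 * |t| + t ^+ 2 / 2)]: in the 3, one
    unit comes from the law and two from [enorm m <= 2 * K], while [1 <= K] controls the quadratic
    term. *)
Let V v (x : d.-tuple R) := (\sum_k v k * (tnth x k - m k)) / (K * enorm v).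
Let Y v x := w x * V v x.

Let mV v : measurable_fun setT (V v).
Proof.
apply: measurable_funM => //; apply: measurable_sum => k.
apply: measurable_funM => //; apply: measurable_funB => //.
exact: measurable_tnth.
Qed.

Let mY v : measurable_fun setT (Y v).
Proof. exact: measurable_funM. Qed.

Let YV v x : `|Y v x| <= `|V v x|.
Proof. by rewrite normrM ger0_norm// ler_piMl. Qed.

Let mgfV v t : 0 < enorm v ->
  (\int[Q]_x (expR (t * V v x))%:E <= (expR (3 * `|t| + t ^+ 2 / 2))%:E)%E.
Proof.
move=> v0; set a := t / (K * enorm v).
have K0 : 0 < K by exact: lt_le_trans K1.
have Kv0 : 0 < K * enorm v by rewrite mulr_gt0.
have av : enorm (fun k => a * v k) = `|t| / K.
  rewrite enormZ normrM normfV (gtr0_norm Kv0); field.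
  by rewrite !gt_eqF.
have e x : expR (t * V v x) =
    expR (- (\sum_k (a * v k) * m k)) * expR (\sum_k (a * v k) * tnth x k).
  rewrite -expRD /V mulrA mulrAC -/a; congr expR.
  rewrite addrC -sumrB mulr_sumr; apply: eq_bigr => k _; ring.
under eq_integral do rewrite e EFinM.
rewrite ge0_integralZl//=; last first.
  apply/measurable_EFinP; apply: measurableT_comp => //.
  by apply: measurable_sum => k; apply: measurable_funM => //; exact: measurable_tnth.
apply: (@le_trans _ _ ((expR (2 * `|t|))%:E *
    (expR (K * (`|t| / K) + (`|t| / K) ^+ 2 / 2))%:E)%E).
  apply: lee_pmul; rewrite ?lee_fin ?expR_ge0//.
  - by apply: integral_ge0 => x _; rewrite lee_fin expR_ge0.
  - rewrite ler_expR -sumrN.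
    under eq_bigr do rewrite -mulrN.
    rewrite (le_trans (cauchy_schwarz_enorm _ _))// enormN av.
    rewrite (le_trans (ler_wpM2l _ mK))// ?divr_ge0// ?(ltW K0)//.
    by rewrite mulrCA divfK ?gt_eqF// mulrC.
  - by rewrite -av; exact: mgfQ.
rewrite -EFinM lee_fin -expRD ler_expR mulrCA divff ?gt_eqF// mulr1.
have : (`|t| / K) ^+ 2 <= t ^+ 2.
  rewrite -[leRHS]real_normK ?num_real// lerXn2r// ?nnegrE ?divr_ge0// ?(ltW K0)//.
  by rewrite ler_pdivrMr// ler_peMr.
lra.
Qed.

Let fY v x : 0 < enorm v ->
  \sum_k v k * f x k = K * enorm v * Y v x.
Proof.
move=> v0; have Kv0 : K * enorm v != 0.
  by rewrite gt_eqF// mulr_gt0// (lt_le_trans _ K1).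
rewrite /Y /V mulrCA [X in _ * X]mulrC divfK// mulr_sumr.
by apply: eq_bigr => k _; rewrite mulrCA.
Qed.

Lemma weighted_displacement_integrable k : Q.-integrable setT (EFin \o (fun x => f x k)).
Proof.
pose v : 'I_d -> R := fun i => (i == k)%:R.
have sv (u : 'I_d -> R) : \sum_i v i * u i = u k.
  rewrite (bigD1 k)//= /v eqxx mul1r big1 ?addr0// => i /negbTE ->.
  by rewrite mul0r.
have v1 : enorm v = 1.
  by rewrite /enorm; under eq_bigr do rewrite expr2; rewrite sv /v eqxx sqrtr1.
have v0 : 0 < enorm v by rewrite v1.
have := subgaussian_integrable (mY v) (mV v) (YV v) (fun t => mgfV t v0).
move=> /(integrableZl measurableT (K * enorm v)).
apply: eq_integrable => // x _ /=.
by rewrite -EFinM -fY// sv.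
Qed.

Lemma weighted_displacement_mean v :
  \sum_k v k * G k = \int[Q]_x (\sum_k v k * f x k).
Proof.
have ivf k : Q.-integrable setT (fun x => (v k * f x k)%:E).
  by have := integrableZl measurableT (v k) (weighted_displacement_integrable k).
rewrite /Rintegral; under eq_integral do rewrite -sumEFin.
rewrite integral_sum//= -sum_fine/=; last first.
  by move=> k _; exact: integrable_fin_num.
by apply: eq_bigr => k _; exact/esym/RintegralZl/weighted_displacement_integrable.
Qed.

Let sum_eq0 v : enorm v = 0 -> forall u, \sum_k v k * u k = 0.
Proof. by move=> v0 u; rewrite big1// => k _; rewrite enorm_eq0// mul0r. Qed.

Let mean_Y v : 0 < enorm v ->
  \sum_k v k * G k = K * enorm v * \int[Q]_x Y v x.
Proof.
move=> v0; rewrite weighted_displacement_mean.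
under eq_Rintegral do rewrite fY//.
rewrite RintegralZl//.
exact: (subgaussian_integrable (mY v) (mV v) (YV v) (fun t => mgfV t v0)).
Qed.

(** Duality: the mean vector is tested in its own direction, which leaves a scalar mean. *)
Lemma enorm_weighted_displacement :
  enorm (fun k => G k) <= K * subgaussian_mean R.
Proof.
set g := fun k => G k.
have c0 : 0 <= subgaussian_mean R by rewrite mulr_ge0// expR_ge0.
have K0 : 0 <= K by exact: le_trans K1.
have [->|g0] := eqVneq (enorm g) 0; first exact: mulr_ge0.
have {}g0 : 0 < enorm g by rewrite lt0r g0 enorm_ge0.
have : enorm g ^+ 2 <= K * enorm g * subgaussian_mean R.
  rewrite enorm_sqr; under eq_bigr do rewrite expr2.
  rewrite (mean_Y g0) ler_wpM2l ?mulr_ge0 ?enorm_ge0// (le_trans (ler_norm _))//.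
  exact: (subgaussian_mean_le (mY g) (mV g) (YV g) (fun t => mgfV t g0)).
by rewrite expr2 mulrAC ler_pM2r.
Qed.

Lemma centered_weighted_displacement_mgf v :
  (\int[Q]_x (expR (\sum_k v k * (f x k - G k)))%:E <=
   (expR (subgaussian_variance R * K ^+ 2 * enorm v ^+ 2))%:E)%E.
Proof.
have [v0|v0] := eqVneq (enorm v) 0.
  rewrite v0 expr0n/= mulr0 expR0.
  under eq_integral do rewrite sum_eq0// expR0.
  by rewrite integral_cst// mul1e probability_le1.
have {}v0 : 0 < enorm v by rewrite lt0r v0 enorm_ge0.
have := subgaussian_centered_mgf (mY v) (mV v) (YV v) (fun t => mgfV t v0)
  (K * enorm v).
rewrite exprMn mulrA; apply: le_trans.
rewrite le_eqVlt; apply/orP; left; apply/eqP; apply: eq_integral => x _.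
congr (expR _)%:E; rewrite mulrBr -fY// -mean_Y// -sumrB.
by apply: eq_bigr => k _; rewrite mulrBr.
Qed.

End weighted_displacement.

(** * Dependence of the weights on the parameters *)

Section weights.
Context (R : realType) (M d : nat) (pi : 'I_M -> R).
Hypothesis pi0 : forall i, 0 < pi i.
Implicit Types (x m : 'I_d -> R) (mu nu : 'I_M -> 'I_d -> R) (i : 'I_M).

Lemma phiE x m :
  phi x m = normal_peak 1 ^+ d * expR (- (\sum_k (x k - m k) ^+ 2) / 2).
Proof.
rewrite /phi; under eq_bigr do rewrite normal_pdf1E.
rewrite big_split/= prodr_const card_ord -expR_sum -mulr_suml sumrN.
by [].
Qed.

Lemma phi_gt0 x m : 0 < phi x m.
Proof. by rewrite phiE mulr_gt0 ?expR_gt0// exprn_gt0// normal_peak_gt0// oner_eq0. Qed.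

Lemma mixture_gt0 i x mu : 0 < \sum_j pi j * phi x (mu j).
Proof.
rewrite (bigD1 i)//= ltr_wpDr ?mulr_gt0 ?phi_gt0//.
by apply: sumr_ge0 => j _; rewrite ltW// mulr_gt0 ?phi_gt0.
Qed.

Lemma wgt_ge0 i x mu : 0 <= wgt pi i x mu.
Proof. by rewrite divr_ge0 ?mulr_ge0 ?ltW ?phi_gt0// (mixture_gt0 i). Qed.

Lemma wgt_le1 i x mu : wgt pi i x mu <= 1.
Proof.
rewrite ler_pdivrMr ?(mixture_gt0 i)// mul1r (bigD1 i)//= lerDl.
by apply: sumr_ge0 => j _; rewrite ltW// mulr_gt0 ?phi_gt0.
Qed.

Lemma measurable_wgt i mu :
  measurable_fun setT (fun x : d.-tuple R => wgt pi i (tnth x) mu).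
Proof.
have mphi j : measurable_fun setT (fun x : d.-tuple R => phi (tnth x) (mu j)).
  apply: measurable_prod => k _.
  apply: (measurableT_comp (measurable_normal_pdf _ _)).
  exact: measurable_tnth.
have mpiphi j : measurable_fun setT
    (fun x : d.-tuple R => pi j * phi (tnth x) (mu j)) by exact: measurable_funM.
apply: measurable_funM => //.
have mS : measurable_fun setT
    (fun x : d.-tuple R => \sum_j pi j * phi (tnth x) (mu j)).
  exact: measurable_sum.
(* The positive denominator is inverted as [expR (- ln _)], a composition of measurable
   functions. *)
under eq_fun do rewrite -[X in X^-1]lnK ?posrE ?(mixture_gt0 i)// -expRN.
apply: measurableT_comp => //; apply: measurableT_comp => //.
exact: (measurableT_comp (@measurable_ln R) mS).
Qed.

(** The difference of the squared distances to [m'] and [m] is [<m - m', 2 x - m - m'>];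
    Cauchy-Schwarz bounds it. *)
Lemma phi_ratio_le (K delta : R) x m m' :
  enorm m <= 2 * K -> enorm m' <= 2 * K ->
  enorm (fun k => m k - m' k) <= delta ->
  phi x m <= expR (delta * (enorm x + 2 * K)) * phi x m'.
Proof.
move=> mK mK' mm'; rewrite !phiE mulrCA ler_wpM2l ?exprn_ge0 ?normal_peak_ge0//.
rewrite -expRD ler_expR.
have d0 : 0 <= delta by exact: le_trans (enorm_ge0 _) mm'.
suff : \sum_k (x k - m' k) ^+ 2 - \sum_k (x k - m k) ^+ 2 <=
    2 * (delta * (enorm x + 2 * K)) by lra.
have -> : \sum_k (x k - m' k) ^+ 2 - \sum_k (x k - m k) ^+ 2 =
    \sum_k (m k - m' k) * ((2 * x k - m k) - m' k).
  by rewrite -sumrB; apply: eq_bigr => k _; ring.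
apply: le_trans (cauchy_schwarz_enorm _ _) _.
apply: (@le_trans _ _ (delta * (2 * enorm x + 2 * K + 2 * K))); last lra.
apply: ler_pM => //; rewrite ?enorm_ge0//.
apply: le_trans (le_enormB _ _) _; apply: lerD => //.
apply: le_trans (le_enormB _ _) _; apply: lerD => //.
by rewrite enormZ ger0_norm.
Qed.

Section perturbation.
Variables (K delta : R) (mu nu : 'I_M -> 'I_d -> R).
Hypotheses (K1 : 1 <= K).
Hypothesis muK : forall i, enorm (mu i) <= 2 * K.
Hypothesis nuK : forall i, enorm (nu i) <= 2 * K.
Hypothesis munu : forall i, enorm (fun k => mu i k - nu i k) <= delta.

(** Numerator and denominator each cost one density ratio, hence the factor 2. *)
Lemma wgt_ratio_le i x : wgt pi i x mu <=
  expR (2 * (delta * (enorm x + 2 * K))) * wgt pi i x nu.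
Proof.
set e := delta * _; have numu j : enorm (fun k => nu j k - mu j k) <= delta.
  by rewrite -enormN; under eq_fun do rewrite opprB.
rewrite /wgt mulrA ler_pdivrMr ?(mixture_gt0 i)//.
rewrite mulrAC ler_pdivlMr ?(mixture_gt0 i)//.
rewrite (_ : 2 * e = e + e); last ring.
rewrite expRD.
have h1 : pi i * phi x (mu i) <= expR e * (pi i * phi x (nu i)).
  by rewrite mulrCA ler_pM2l//; exact: phi_ratio_le.
have h2 : \sum_j pi j * phi x (nu j) <= expR e * \sum_j pi j * phi x (mu j).
  rewrite mulr_sumr; apply: ler_sum => j _.
  by rewrite mulrCA ler_pM2l//; exact: phi_ratio_le.
apply: le_trans (ler_pM _ _ h1 h2) _; last lra.
- by rewrite ltW// mulr_gt0 ?phi_gt0.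
- by rewrite ltW// (mixture_gt0 i).
Qed.

(** From [s <= expR e * t] and [s <= 1], the inequality [1 - e <= expR (- e)] gives [s - t <= e]; no
    derivative of the weights is taken. *)
Lemma wgt_sub_le i x : wgt pi i x mu - wgt pi i x nu <=
  2 * (delta * (enorm x + 2 * K)).
Proof.
have := wgt_ratio_le i x; set e := 2 * _ => h.
have e0 : 0 <= e.
  rewrite !mulr_ge0// ?(le_trans (enorm_ge0 _) (munu i))//.
  by rewrite addr_ge0 ?enorm_ge0// mulr_ge0// (le_trans _ K1).
have h1 := wgt_le1 i x mu; have h0 := wgt_ge0 i x mu.
have h2 : (1 - e) * wgt pi i x mu <= expR (- e) * wgt pi i x mu.
  by rewrite ler_wpM2r// (le_trans _ (expR_ge1Dx _)).
have h3 : expR (- e) * wgt pi i x mu <= wgt pi i x nu.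
  by rewrite expRN ler_pdivrMl ?expR_gt0.
have h4 : e * wgt pi i x mu <= e * 1 by rewrite ler_wpM2l.
lra.
Qed.

End perturbation.

Lemma weighted_displacement_lipschitz (K delta : R) mu nu i x k :
  1 <= K -> (forall i, enorm (mu i) <= 2 * K) ->
  (forall i, enorm (nu i) <= 2 * K) ->
  (forall i, enorm (fun k => mu i k - nu i k) <= delta) ->
  `|wgt pi i x mu * (x k - mu i k) - wgt pi i x nu * (x k - nu i k)| <=
  delta * (6 * enorm x ^+ 2 + 24 * K ^+ 2).
Proof.
move=> K1 muK nuK munu.
have numu j : enorm (fun k => nu j k - mu j k) <= delta.
  by rewrite -enormN; under eq_fun do rewrite opprB.
have d0 : 0 <= delta by exact: le_trans (enorm_ge0 _) (munu i).
set b := enorm x + 2 * K.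
have b1 : 1 <= b by rewrite /b; have := enorm_ge0 x; lra.
have hw : `|wgt pi i x mu - wgt pi i x nu| <= 2 * (delta * b).
  by rewrite ler_norml lerNl opprB !wgt_sub_le.
move: hw (wgt_ge0 i x nu) (wgt_le1 i x nu).
move: (wgt pi i x mu) (wgt pi i x nu) => s t hw t0 t1.
have -> : s * (x k - mu i k) - t * (x k - nu i k) =
    (s - t) * (x k - mu i k) + t * (nu i k - mu i k) by ring.
apply: (@le_trans _ _ (2 * (delta * b) * b + 1 * delta)).
  apply: le_trans (ler_normD _ _) _; rewrite !normrM; apply: lerD.
    apply: ler_pM => //; apply: le_trans (ler_normB _ _) _.
    by apply: lerD; rewrite (le_trans (le_coord_enorm _ _)).
  apply: ler_pM => //; first by rewrite ger0_norm.
  exact: le_trans (le_coord_enorm (fun k => nu i k - mu i k) k) (numu i).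
have bb : 1 <= b ^+ 2 by rewrite expr_ge1// (le_trans _ b1).
have b2 : 3 * b ^+ 2 <= 6 * enorm x ^+ 2 + 24 * K ^+ 2.
  by have := sqr_ge0 (enorm x - 2 * K); rewrite /b; nra.
have := ler_wpM2l d0 b2; have := ler_wpM2l d0 bb; lra.
Qed.

End weights.

(** Coordinatewise, [y ^+ 2 <= 2 * expR |y|] at [y = x_k / K] reduces the square to two exponential
    moments, each at most [expR (3 / 2)]. *)
Lemma second_moment_le (R : realType) (d : nat) (Q : probability (d.-tuple R) R)
    (K : R) : 1 <= K ->
  (forall v : 'I_d -> R, (\int[Q]_x (expR (\sum_k v k * tnth x k))%:E <=
     (expR (K * enorm v + enorm v ^+ 2 / 2))%:E)%E) ->
  (\int[Q]_x (enorm (tnth x) ^+ 2)%:E <= (d%:R * (4 * expR (3 / 2) * K ^+ 2))%:E)%E.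
Proof.
move=> K1 mgfQ; have K0 : 0 < K by exact: lt_le_trans K1.
have mt k : measurable_fun setT (fun x : d.-tuple R => tnth x k).
  exact: measurable_tnth.
under eq_integral do rewrite enorm_sqr -sumEFin.
rewrite ge0_integral_sum//=; last 2 first.
- by move=> k; apply/measurable_EFinP; exact: measurable_funX.
- by move=> k x _; rewrite lee_fin sqr_ge0.
rewrite -[d in leRHS]card_ord -sum1_card natr_sum mulr_suml -sumEFin.
apply: lee_sum => k _; rewrite mul1r.
have mgfk a : (\int[Q]_x (expR (a / K * tnth x k))%:E <=
    (expR (`|a| + `|a| ^+ 2 / 2))%:E)%E.
  have := mgfQ (fun i => a / K * (i == k)%:R).
  have -> : enorm (fun i : 'I_d => a / K * (i == k)%:R) = `|a| / K.
    rewrite enormZ normrM normfV (gtr0_norm K0) -[RHS]mulr1; congr (_ * _).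
    rewrite /enorm (bigD1 k)//= eqxx big1 ?addr0 ?expr1n ?sqrtr1// => i.
    by move=> /negbTE ->; rewrite expr0n.
  move=> h; apply: le_trans (le_trans h _).
    rewrite le_eqVlt; apply/orP; left; apply/eqP/eq_integral => x _.
    rewrite (bigD1 k)//= eqxx mulr1 big1 ?addr0// => i /negbTE ->.
    by rewrite mulr0 mul0r.
  rewrite lee_fin ler_expR mulrCA divff ?gt_eqF// mulr1 lerD2l.
  rewrite ler_pM2r// lerXn2r ?nnegrE ?divr_ge0// ?(ltW K0)//.
  by rewrite ler_pdivrMr// ler_peMr.
have me a : measurable_fun setT (fun x : d.-tuple R => expR (a / K * tnth x k)).
  by apply: measurableT_comp => //; exact: measurable_funM.
apply: (@le_trans _ _ (\int[Q]_x ((2 * K ^+ 2)%:E *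
    ((expR (1 / K * tnth x k))%:E + (expR (- 1 / K * tnth x k))%:E)))%E).
  apply: ge0_le_integral => //.
  - by move=> x _; rewrite lee_fin sqr_ge0.
  - by apply/measurable_EFinP; exact: measurable_funX.
  - apply: measurable_funeM; apply: emeasurable_funD; exact/measurable_EFinP.
  - move=> x _; rewrite -EFinD -EFinM lee_fin.
    have -> : tnth x k ^+ 2 = K ^+ 2 * `|1 / K * tnth x k| ^+ 2.
      by rewrite real_normK ?num_real//; field; rewrite gt_eqF.
    have := le_trans (sqr_le_expR (normr_ge0 _))
      (ler_wpM2l (ler0n _ 2) (expR_norm_le (1 / K * tnth x k))).
    move=> /(ler_wpM2l (sqr_ge0 K)); rewrite -!mulNr; lra.
rewrite ge0_integralZl//=.
- rewrite ge0_integralD//=.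
  + apply: (@le_trans _ _ ((2 * K ^+ 2)%:E * ((expR (3 / 2))%:E + (expR (3 / 2))%:E))%E).
      rewrite lee_wpmul2l//; first by rewrite lee_fin mulr_ge0// sqr_ge0.
      by apply: leeD; rewrite (le_trans (mgfk _))// lee_fin ler_expR
        ?normrN normr1 expr1n; lra.
    by rewrite -EFinD -EFinM lee_fin; lra.
  + exact/measurable_EFinP.
  + exact/measurable_EFinP.
- by apply: emeasurable_funD; exact/measurable_EFinP.
- by move=> x _; rewrite adde_ge0.
- by rewrite lee_fin mulr_ge0// sqr_ge0.
Qed.

(** * Samples *)

Section iid_sample.
Context (R : realType) (d n : nat) (Q : probability (d.-tuple R) R) (K : R).
Context (dO : measure_display) (O : measurableType dO) (P : probability O R).
Variable X : 'I_n -> O -> d.-tuple R.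
Hypothesis mX : forall j, measurable_fun setT (X j).
Hypothesis lawX : forall j (A : set (d.-tuple R)), measurable A ->
  P (X j @^-1` A) = Q A.
Hypothesis indX : mutually_independent P X.
Hypothesis K1 : 1 <= K.
Hypothesis mgfQ : forall v : 'I_d -> R,
  (\int[Q]_x (expR (\sum_k v k * tnth x k))%:E <=
   (expR (K * enorm v + enorm v ^+ 2 / 2))%:E)%E.

Lemma iid_integral_prod_le (f : 'I_n -> d.-tuple R -> R) (a : R) :
  (forall j, measurable_fun setT (f j)) -> (forall j x, 0 <= f j x) ->
  (forall j, (\int[Q]_x (f j x)%:E <= a%:E)%E) ->
  (\int[P]_w (\prod_j f j (X j w))%:E <= (a ^+ n)%:E)%E.
Proof.
move=> mf f0 fa.
have f0' j : (0 <= \int[Q]_x (f j x)%:E)%E.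
  by apply: integral_ge0 => x _; rewrite lee_fin.
have ffin j : (\int[Q]_x (f j x)%:E)%E \is a fin_num.
  by rewrite ge0_fin_numE// (le_lt_trans (fa j))// ltry.
rewrite (@integral_prod_rect _ _ _ _ _ P n X mX unit (fun=> 1) (fun _ _ => Q)
    _ _ f (fun _ j => fine (\int[Q]_x (f j x)%:E)))//.
- rewrite lee_fin big_const card_unit/= addr0 mul1r.
  rewrite -[n in leRHS]card_ord -prodr_const; apply: ler_prod => j _.
  by rewrite fine_ge0//= -lee_fin fineK.
- move=> B mB; rewrite big_const card_unit/= adde0 mul1e.
  rewrite [LHS](indX mB); apply: eq_bigr => j _; exact: lawX.
- by move=> _ j; rewrite fineK.
Qed.

Lemma iid_integral_comp (f : d.-tuple R -> R) j :
  measurable_fun setT f -> (forall x, 0 <= f x) ->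
  (\int[P]_w (f (X j w))%:E = \int[Q]_x (f x)%:E)%E.
Proof.
move=> mf f0.
transitivity (\int[P]_w (f (X j w) * 1)%:E)%E.
  by apply: eq_integral => w _; rewrite mulr1.
rewrite (@ge0_integral_weighted_comp _ _ _ _ _ P (X j) (cst 1) (mX j) _ _
  unit (fun=> 1) (fun=> Q))//.
- by rewrite big_const card_unit/= adde0 mul1e.
- move=> A mA; rewrite big_const card_unit/= adde0 mul1e -(lawX j mA).
  transitivity (\int[P]_w (\1_(X j @^-1` A) w)%:E)%E.
    by apply: eq_integral => w _; rewrite mulr1.
  rewrite integral_indic//= ?setIT// -[X in measurable X]setTI; exact: mX.
Qed.

Let dot_measurable d1 (T : measurableType d1) (v y : T -> d.-tuple R) :
  measurable_fun setT v -> measurable_fun setT y ->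
  measurable_fun setT (fun z => \sum_k tnth (v z) k * tnth (y z) k).
Proof.
move=> mv my; apply: measurable_sum => k; apply: measurable_funM.
  exact: (measurableT_comp (measurable_tnth k) mv).
exact: (measurableT_comp (measurable_tnth k) my).
Qed.

(** The linear term is traded by [K * |v| <= K ^+ 2 / 2 + |v| ^+ 2 / 2], to reach the form
    [A * expR (B * |v| ^+ 2)] required for Gaussian averaging. *)
Let mgf_le (v : d.-tuple R) :
  (\int[Q]_x (expR (\sum_k tnth v k * tnth x k))%:E <=
   (expR (K ^+ 2 / 2) * expR (\sum_k tnth v k ^+ 2))%:E)%E.
Proof.
apply: le_trans (mgfQ (tnth v)) _; rewrite lee_fin -expRD ler_expR.
by rewrite -enorm_sqr; have := sqr_ge0 (K - enorm (tnth v)); lra.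
Qed.

Let mX2 j : measurable_fun setT (fun z : d.-tuple R * O => X j z.2).
Proof. exact: (measurableT_comp (mX j) measurable_snd). Qed.

Let mdotX j :
  measurable_fun setT (fun z : d.-tuple R * O => \sum_k tnth z.1 k * tnth (X j z.2) k).
Proof. by apply: dot_measurable. Qed.

Lemma sample_norm_bound lam : exists E : set O, [/\ measurable E,
  ((1 - n%:R * expR (K ^+ 2 / 2) * 2 ^+ d * expR (- lam))%:E <= P E)%E &
  forall w, E w -> forall j, enorm (tnth (X j w)) ^+ 2 <= 8 * lam].
Proof.
pose F (z : d.-tuple R * O) :=
  (\sum_j expR (\sum_k tnth z.1 k * tnth (X j z.2) k))%:E.
have [| ||v|E [mE PE HE]] := @gaussian_average_tail _ _ _ P 1 d F
  (n%:R * expR (K ^+ 2 / 2)) lam ltr01.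
- by rewrite mulr_ge0// expR_ge0.
- apply/measurable_EFinP; apply: measurable_sum => j.
  by apply: measurableT_comp => //; exact: mdotX.
- by move=> z; rewrite lee_fin sumr_ge0// => j _; exact: expR_ge0.
- rewrite /F/=; under eq_integral do rewrite -sumEFin.
  have me : measurable_fun setT (fun x : d.-tuple R => expR (\sum_k tnth v k * tnth x k)).
    by apply: measurableT_comp => //; exact: dot_measurable.
  rewrite ge0_integral_sum//=; last first.
    by move=> j; apply/measurable_EFinP; exact: (measurableT_comp me (mX j)).
  rewrite -[n in leRHS]card_ord -sum1_card natr_sum -mulrA mulr_suml -sumEFin.
  apply: lee_sum => j _; rewrite 2!mul1r.
  by rewrite (iid_integral_comp j me)//; exact: mgf_le.
exists E; split => // w Ew j; rewrite enorm_sqr.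
have := HE w (tnth (X j w)) Ew; rewrite mulr1; apply => v.
rewrite lee_fin (bigD1 j)//= lerDl.
by apply: sumr_ge0 => i _; exact: expR_ge0.
Qed.

(** For [0 <= t <= 1], [expR (t * y) <= 1 + expR y], so one product dominates all choices of
    weights. The price is exponential in [n], affordable when [n < d]. *)
Lemma weighted_sum_bound lam : (0 < n)%N -> exists E : set O, [/\ measurable E,
  ((1 - (2 * expR (K ^+ 2 / 2)) ^+ n * 2 ^+ d * expR (- lam))%:E <= P E)%E &
  forall w, E w -> forall t : 'I_n -> R, (forall j, 0 <= t j <= 1) ->
    enorm (fun k => \sum_j t j * tnth (X j w) k) ^+ 2 <= 8 * n%:R * lam].
Proof.
move=> n0.
pose F (z : d.-tuple R * O) :=
  (\prod_j (1 + expR (\sum_k tnth z.1 k * tnth (X j z.2) k)))%:E.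
have [| |||v|E [mE PE HE]] := @gaussian_average_tail _ _ _ P n%:R d F
  ((2 * expR (K ^+ 2 / 2)) ^+ n) lam.
- by rewrite ltr0n.
- by rewrite exprn_ge0// mulr_ge0// expR_ge0.
- apply/measurable_EFinP; apply: measurable_prod => j _.
  apply: measurable_funD => //.
  by apply: measurableT_comp => //; exact: mdotX.
- by move=> z; rewrite lee_fin; apply: prodr_ge0 => j _; rewrite addr_ge0 ?expR_ge0.
- rewrite expRM_natl -exprMn.
  have me : measurable_fun setT (fun x : d.-tuple R => expR (\sum_k tnth v k * tnth x k)).
    by apply: measurableT_comp => //; exact: dot_measurable.
  apply: (iid_integral_prod_le (f := fun _ x => 1 + expR (\sum_k tnth v k * tnth x k))).
  + by move=> j; exact: measurable_funD.
  + by move=> j x; rewrite addr_ge0// expR_ge0.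
  + move=> j; under eq_integral do rewrite EFinD.
    rewrite ge0_integralD//=; [|by apply/measurable_EFinP].
    rewrite integral_cst// [X in (_ * X)%E](@probability_setT _ _ _ Q) mule1.
    apply: le_trans (leeD2l _ (mgf_le v)) _; rewrite -EFinD lee_fin.
    set a := expR _; set b := expR _.
    have : 1 * 1 <= a * b.
      apply: ler_pM => //; rewrite -expR0 ler_expR.
        by rewrite mulr_ge0// sqr_ge0.
      exact: sumsq_ge0.
    lra.
exists E; split => // w Ew t t01; rewrite enorm_sqr.
apply: (HE w _ Ew) => v; rewrite lee_fin.
rewrite (_ : \sum_k _ = \sum_j t j * \sum_k tnth v k * tnth (X j w) k).
  rewrite expR_sum; apply: ler_prod => j _; rewrite expR_ge0/=.
  have /andP[t0 t1] := t01 j; set y := \sum_k _.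
  have [y0|y0] := leP 0 y.
    rewrite (@le_trans _ _ (expR y))//; last by rewrite lerDr.
    by rewrite ler_expR ler_piMl.
  apply: (@le_trans _ _ 1); last by rewrite lerDl expR_ge0.
  by rewrite -expR0 ler_expR mulr_ge0_le0// ltW.
under eq_bigr do rewrite mulr_sumr.
rewrite exchange_big/=; apply: eq_bigr => j _; rewrite mulr_sumr.
by apply: eq_bigr => k _; rewrite mulrCA.
Qed.

(** The union bound sits inside [F], a sum over [J]: its integral gains the factor [#|J|], and
    dropping all summands but one recovers each member. *)
Lemma finite_family_concentration (J : finType) (W : J -> d.-tuple R -> R)
    (m : J -> 'I_d -> R) lam : (0 < n)%N ->
  (forall i, measurable_fun setT (W i)) ->
  (forall i x, 0 <= W i x) -> (forall i x, W i x <= 1) ->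
  (forall i, enorm (m i) <= 2 * K) ->
  exists E : set O, [/\ measurable E,
  ((1 - #|J|%:R * 2 ^+ d * expR (- lam))%:E <= P E)%E &
  forall w, E w -> forall i,
    enorm (fun k => \int[Q]_x (W i x * (tnth x k - m i k)) -
      n%:R^-1 * \sum_j W i (X j w) * (tnth (X j w) k - m i k)) ^+ 2 <=
    8 * subgaussian_variance R * K ^+ 2 * lam / n%:R].
Proof.
move=> n0 mW W0 W1 mK.
have n0' : 0 < n%:R :> R by rewrite ltr0n.
have K0 : 0 < K by exact: lt_le_trans K1.
pose C := subgaussian_variance R.
have C0 : 0 < C.
  have e := expR_gt0 (2 * subgaussian_mean R + 8).
  have e' := expR_gt0 (3 + 2^-1 : R).
  rewrite /C /subgaussian_variance {2}/subgaussian_mean; lra.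
pose g i k := \int[Q]_x (W i x * (tnth x k - m i k)).
pose f i x k := W i x * (tnth x k - m i k) - g i k.
have mf i k : measurable_fun setT (fun x : d.-tuple R => f i x k).
  apply: measurable_funB => //; apply: measurable_funM => //.
  apply: measurable_funB => //; exact: measurable_tnth.
pose F (z : d.-tuple R * O) :=
  (\sum_i \prod_j expR (\sum_k tnth z.1 k * f i (X j z.2) k))%:E.
have me i v : measurable_fun setT (fun x : d.-tuple R =>
    expR (\sum_k tnth v k * f i x k)).
  apply: measurableT_comp => //; apply: measurable_sum => k.
  exact: measurable_funM.
have [| |||v|E [mE PE HE]] := @gaussian_average_tail _ _ _ P
  (n%:R * (C * K ^+ 2)) d F #|J|%:R lam.
- by rewrite !mulr_gt0// exprn_gt0.
- by [].
- apply/measurable_EFinP; apply: measurable_sum => i.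
  apply: measurable_prod => j _; apply: measurableT_comp => //.
  apply: measurable_sum => k; apply: measurable_funM.
    exact: (measurableT_comp (measurable_tnth k) measurable_fst).
  exact: (measurableT_comp (mf i k) (mX2 j)).
- move=> z; rewrite lee_fin; apply: sumr_ge0 => i _.
  by apply: prodr_ge0 => j _; exact: expR_ge0.
- rewrite /F/=; under eq_integral do rewrite -sumEFin.
  rewrite ge0_integral_sum//=; last 2 first.
  + move=> i; apply/measurable_EFinP; apply: measurable_prod => j _.
    exact: (measurableT_comp (me i v) (mX j)).
  + by move=> i x _; rewrite lee_fin; apply: prodr_ge0 => j _; exact: expR_ge0.
  rewrite -sum1_card natr_sum mulr_suml -sumEFin; apply: lee_sum => i _.
  rewrite mul1r -mulrA expRM_natl.
  apply: (iid_integral_prod_le (f := fun _ x => expR (\sum_k tnth v k * f i x k))).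
  + by move=> j; exact: me.
  + by move=> j x; exact: expR_ge0.
  + move=> j; rewrite -enorm_sqr.
    exact: (centered_weighted_displacement_mgf K1 mgfQ (mW i) (W0 i) (W1 i) (mK i)).
exists E; split => // w Ew i.
have /(_ _)/= := HE w (fun k => \sum_j f i (X j w) k) Ew.
rewrite -enorm_sqr => h.
have -> : enorm (fun k => g i k -
    n%:R^-1 * \sum_j W i (X j w) * (tnth (X j w) k - m i k)) =
    n%:R^-1 * enorm (fun k => \sum_j f i (X j w) k).
  rewrite -[n%:R^-1 in RHS]ger0_norm ?invr_ge0// -normrN -enormZ.
  congr enorm; apply/funext => k.
  rewrite /f sumrB sumr_const card_ord -[g i k *+ n]mulr_natr; field.
  by rewrite gt_eqF.
rewrite exprMn; apply: le_trans (ler_wpM2l _ (h _)) _.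
- by rewrite sqr_ge0.
- move=> v; rewrite lee_fin (bigD1 i)//= -expR_sum.
  under eq_bigr do rewrite mulr_sumr.
  rewrite exchange_big/= lerDl; apply: sumr_ge0 => i' _.
  by apply: prodr_ge0 => j _; exact: expR_ge0.
- by rewrite le_eqVlt; apply/orP; left; apply/eqP; rewrite -/C; field; rewrite gt_eqF.
Qed.

End iid_sample.

(** * Nets of parameters *)

(** Rounding towards zero never enlarges a coordinate, so net points stay in the ball where the
    moment and Lipschitz bounds apply. A grid point is a sign and a truncated quotient. *)
Lemma round_to_zero (R : realType) (N : nat) (h y : R) : 0 < h -> `|y| <= N%:R * h ->
  exists z : bool * 'I_N.+1,
    let g := (-1) ^+ z.1 * (z.2%:R * h) in `|g| <= `|y| /\ `|y - g| <= h.
Proof.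
move=> h0 yN; have q0 : 0 <= `|y| / h by rewrite divr_ge0// ltW.
have /andP[t1 t2] := truncn_itv q0; set t := Num.truncn _ in t1 t2.
have tN : (t < N.+1)%N.
  by rewrite ltnS -(ler_nat R) (le_trans t1)// ler_pdivrMr.
exists (y < 0, Ordinal tN) => /=.
have th1 : t%:R * h <= `|y| by rewrite -ler_pdivlMr.
have th2 : `|y| <= t%:R * h + h.
  by rewrite -[X in _ + X]mul1r -mulrDl natr1 -ler_pdivrMr// ltW.
have th0 : 0 <= t%:R * h by rewrite mulr_ge0// ltW.
split; first by rewrite normrMsign ger0_norm.
rewrite [y in `|y - _|]numEsign -mulrBr normrMsign ger0_norm; lra.
Qed.

Lemma ball_net (R : realType) (M d N : nat) (K h : R) :
  0 < h -> 2 * K <= N%:R * h ->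
  exists (J : finType) (c : J -> 'I_M -> 'I_d -> R),
  [/\ (#|J| <= (2 * N.+1) ^ (M * d))%N, forall j i, enorm (c j i) <= 2 * K &
  forall mu : 'I_M -> 'I_d -> R, (forall i, enorm (mu i) <= 2 * K) ->
    exists j, forall i, enorm (fun k => mu i k - c j i k) <= Num.sqrt d%:R * h].
Proof.
move=> h0 KN.
pose Z := {ffun 'I_M * 'I_d -> bool * 'I_N.+1}.
pose g (z : Z) (i : 'I_M) (k : 'I_d) : R := (-1) ^+ (z (i, k)).1 * ((z (i, k)).2%:R * h).
pose good (z : Z) := [forall i, enorm (g z i) <= 2 * K].
exists {z : Z | good z}, (fun z => g (val z)); split.
- rewrite card_sig (leq_trans (max_card _))//.
  by rewrite card_ffun !card_prod card_bool !card_ord.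
- by move=> [z gz] i /=; exact: (forallP gz).
move=> mu muK.
have /choice[r rP] : forall p : 'I_M * 'I_d, exists z : bool * 'I_N.+1,
    let g := (-1) ^+ z.1 * (z.2%:R * h) in
    `|g| <= `|mu p.1 p.2| /\ `|mu p.1 p.2 - g| <= h.
  move=> [i k]; apply: round_to_zero => //=.
  by rewrite (le_trans (le_coord_enorm _ _))// (le_trans (muK i)).
pose z : Z := [ffun p => r p].
have gz : good z.
  apply/forallP => i; apply: le_trans (muK i).
  rewrite /enorm ler_wsqrtr//; apply: ler_sum => k _.
  have [rk _] := rP (i, k); rewrite -[leLHS]real_normK ?num_real//.
  rewrite -[leRHS]real_normK ?num_real// lerXn2r ?nnegrE//.
  by rewrite /g ffunE.
exists (exist _ z gz) => i /=; apply: enorm_le_coord => k.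
by rewrite /g ffunE; have [_] := rP (i, k).
Qed.

(** * Lipschitz dependence of the gap on the parameters *)

Section gap.
Context (R : realType) (M d n : nat) (pi : 'I_M -> R) (K : R).
Variable Q : probability (d.-tuple R) R.
Hypothesis pi0 : forall i, 0 < pi i.
Hypothesis K1 : 1 <= K.
Hypothesis n0 : (0 < n)%N.
Hypothesis mgfQ : forall v : 'I_d -> R,
  (\int[Q]_x (expR (\sum_k v k * tnth x k))%:E <=
   (expR (K * enorm v + enorm v ^+ 2 / 2))%:E)%E.

Let integrable_wgt mu i k : (forall i, enorm (mu i) <= 2 * K) ->
  Q.-integrable setT (EFin \o (fun x : d.-tuple R =>
    wgt pi i (tnth x) mu * (tnth x k - mu i k))).
Proof.
move=> muK; apply: (weighted_displacement_integrable K1 mgfQ) => //.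
- exact: measurable_wgt.
- by move=> x; exact: wgt_ge0.
- by move=> x; exact: wgt_le1.
Qed.

Lemma gap_lipschitz (xs : 'I_n -> d.-tuple R) (delta T : R) mu nu i k :
  (forall i, enorm (mu i) <= 2 * K) -> (forall i, enorm (nu i) <= 2 * K) ->
  (forall i, enorm (fun k => mu i k - nu i k) <= delta) ->
  (forall j, enorm (tnth (xs j)) ^+ 2 <= T) ->
  `|(Gpop pi Q i mu k - Gemp pi xs i mu k)
    - (Gpop pi Q i nu k - Gemp pi xs i nu k)| <=
  delta * (6 * (d%:R * (4 * expR (3 / 2) * K ^+ 2)) + 6 * T + 48 * K ^+ 2).
Proof.
move=> muK nuK munu xsT.
have d0 : 0 <= delta by exact: le_trans (enorm_ge0 _) (munu i).
have lip x := weighted_displacement_lipschitz pi0 i x k K1 muK nuK munu.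
have n0' : 0 < n%:R :> R by rewrite ltr0n.
have emp : `|Gemp pi xs i mu k - Gemp pi xs i nu k| <=
    delta * (6 * T + 24 * K ^+ 2).
  rewrite /Gemp -mulrBr -sumrB normrM ger0_norm ?invr_ge0//.
  rewrite ler_pdivrMl//; apply: le_trans (ler_norm_sum _ _ _) _.
  rewrite -[n in leRHS]card_ord -sum1_card natr_sum mulr_suml.
  apply: ler_sum => j _; rewrite mul1r (le_trans (lip _))//.
  by rewrite ler_wpM2l// lerD2r ler_pM2l.
have pop : `|Gpop pi Q i mu k - Gpop pi Q i nu k| <=
    delta * (6 * (d%:R * (4 * expR (3 / 2) * K ^+ 2)) + 24 * K ^+ 2).
  have imu := integrable_wgt i k muK; have inu := integrable_wgt i k nuK.
  have iB := integrableB measurableT imu inu.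
  rewrite /Gpop -RintegralB// -lee_fin EFin_normr_Rintegral//.
  apply: le_trans (le_abse_integral _ _ (measurable_int _ iB)) _ => //.
  have me : measurable_fun setT (fun x : d.-tuple R => enorm (tnth x) ^+ 2).
    under eq_fun do rewrite enorm_sqr.
    apply: measurable_sum => l; apply: measurable_funX; exact: measurable_tnth.
  apply: (@le_trans _ _ (\int[Q]_x (delta%:E *
      (6%:E * (enorm (tnth x) ^+ 2)%:E + (24 * K ^+ 2)%:E)))%E).
    apply: ge0_le_integral => //.
    - by apply: measurableT_comp => //; exact: measurable_int iB.
    - apply: measurable_funeM; apply: emeasurable_funD => //.
      by apply: measurable_funeM; apply/measurable_EFinP.
    - by move=> x _; rewrite lee_fin lip.
  have K2 : 0 <= 24 * K ^+ 2 by rewrite mulr_ge0// sqr_ge0.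
  have e0 (x : d.-tuple R) : (0 <= 6%:E * (enorm (tnth x) ^+ 2)%:E :> \bar R)%E.
    by rewrite lee_fin mulr_ge0// sqr_ge0.
  rewrite ge0_integralZl//=; last 2 first.
  - apply: emeasurable_funD => //; apply: measurable_funeM.
    exact/measurable_EFinP.
  - by move=> x _; rewrite adde_ge0.
  rewrite [leRHS]EFinM lee_wpmul2l// ge0_integralD//=; last first.
    by apply: measurable_funeM; exact/measurable_EFinP.
  rewrite ge0_integralZl//=; last 2 first.
  - exact/measurable_EFinP.
  - by move=> x _; rewrite lee_fin sqr_ge0.
  rewrite integral_cst// [X in (_ + _ * X)%E](@probability_setT _ _ _ Q) mule1.
  rewrite [leRHS]EFinD leeD2r// [leRHS]EFinM lee_wpmul2l//.
  exact: second_moment_le.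
rewrite (_ : _ - _ - _ = (Gpop pi Q i mu k - Gpop pi Q i nu k)
   - (Gemp pi xs i mu k - Gemp pi xs i nu k)); last ring.
by rewrite (le_trans (ler_normB _ _))//; lra.
Qed.

End gap.

(** * Numerical bounds *)

Section numeric_bounds.
Context (R : realType).
Implicit Types (K : R) (n d M : nat).

Lemma ln_nat_ge_half n : (2 <= n)%N -> 2^-1 <= ln (n%:R : R).
Proof.
move=> n2; have h : expR (2^-1 : R) <= 2.
  have := expR_ge1Dx (- 2^-1 : R); rewrite expRN => h.
  have e0 := expR_gt0 (2^-1 : R).
  have : 2^-1 * expR (2^-1) <= 1 :> R by rewrite -ler_pdivlMr// div1r; lra.
  lra.
rewrite -ler_expR lnK ?posrE ?ltr0n ?(leq_trans _ n2)//.
by rewrite (le_trans h)// ler_nat.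
Qed.

Lemma expR_ln_nat n : (2 <= n)%N -> expR (ln (n%:R : R)) = n%:R.
Proof. by move=> n2; rewrite lnK// posrE ltr0n (leq_trans _ n2). Qed.

Lemma two_pow_le_expR n d : (2 <= n)%N -> 2 ^+ d <= expR (d%:R * ln n%:R) :> R.
Proof.
by move=> n2; rewrite expRM_natl expR_ln_nat// lerXn2r ?nnegrE// ler_nat.
Qed.

(** Absorbs powers of [K] into the exponent, using [1 <= 2 * ln n]. *)
Lemma le_expR_ln K n : (2 <= n)%N -> 0 <= K -> K <= expR (2 * K * ln n%:R).
Proof.
move=> n2 K0; have l2 := ln_nat_ge_half n2.
apply: le_trans (_ : K <= expR K) _.
  by have := expR_ge1Dx K; lra.
rewrite ler_expR; have := ler_wpM2l K0 l2; lra.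
Qed.

Lemma expR_failure_sum n d : (2 <= n)%N -> (1 <= d)%N ->
  expR (- (2 * (d%:R * ln n%:R))) + expR (- (2 * (d%:R * ln n%:R))) <=
  expR (- (d%:R * ln n%:R)) :> R.
Proof.
move=> n2 d1; set a := d%:R * _.
have h : 2 * expR (- a) <= 1.
  rewrite expRN ler_pdivrMr ?expR_gt0// mul1r.
  rewrite /a expRM_natl expR_ln_nat// (@le_trans _ _ (2 ^+ d))//.
    by rewrite -[leLHS]expr1 ler_weXn2l// ler1n.
  by rewrite lerXn2r ?nnegrE// ler_nat.
have -> : - (2 * a) = - a + - a by ring.
by rewrite expRD; have := ler_wpM2r (expR_ge0 (- a)) h; lra.
Qed.

(** 18 = 13 + 2 + 1 + 2: the net, the factor [M], the factor [2 ^+ d], and the remaining decay. *)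
Lemma net_failure_bound n M d N Jc K : (2 <= n)%N -> (1 <= M)%N -> (1 <= d)%N ->
  1 <= K -> (Jc <= (2 * N.+1) ^ (M * d))%N -> N%:R <= 2 * K ^+ 3 * n%:R ^+ 4 + 1 ->
  (Jc * M)%:R * 2 ^+ d * expR (- (18 * (M%:R * K * d%:R * ln n%:R))) <=
  expR (- (2 * (d%:R * ln n%:R))).
Proof.
move=> n2 M1 d1 K1 JN NK; set l := ln _.
have l2 : 2^-1 <= l := ln_nat_ge_half n2.
have l0 : 0 <= l by exact: le_trans l2.
have K0 : 0 <= K by exact: le_trans K1.
have nR : 2 <= n%:R :> R by rewrite ler_nat.
have MR : 1 <= M%:R :> R by rewrite ler1n.
have dR : 1 <= d%:R :> R by rewrite ler1n.
have en : expR l = n%:R := expR_ln_nat n2.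
(* Here [2 * N.+1 <= 8 * K ^+ 3 * n ^+ 4] and [8 <= n ^+ 3], so the exponent is
   [(3 + 6 * K + 4) * l <= 13 * K * l]. *)
have hN : (2 * N.+1)%:R <= expR (13 * (K * l)).
  have KN : 1 <= K ^+ 3 * n%:R ^+ 4.
    rewrite -[leLHS]mulr1; apply: ler_pM => //.
      by rewrite -[leLHS](expr1n _ 3) lerXn2r ?nnegrE.
    by rewrite -[leLHS](expr1n _ 4) lerXn2r ?nnegrE// (le_trans _ nR)// ler1n.
  apply: (@le_trans _ _ (2 ^+ 3 * (K ^+ 3 * n%:R ^+ 4))).
    by rewrite natrM -natr1; lra.
  apply: (@le_trans _ _ (expR l ^+ 3 * (expR (2 * K * l) ^+ 3 * expR l ^+ 4))).
    apply: ler_pM; rewrite ?mulr_ge0 ?exprn_ge0//.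
      by rewrite lerXn2r ?nnegrE ?expR_ge0// en.
    rewrite en ler_pM ?exprn_ge0//.
    by rewrite lerXn2r ?nnegrE ?expR_ge0// le_expR_ln.
  rewrite -!expRM_natl -!expRD ler_expR.
  have := ler_wpM2r l0 K1; lra.
have hJ : Jc%:R <= expR (13 * (M%:R * K * d%:R * l)).
  apply: (@le_trans _ _ ((2 * N.+1) ^ (M * d))%:R); first by rewrite ler_nat.
  rewrite natrX (le_trans (lerXn2r _ _ _ hN))// ?nnegrE ?expR_ge0//.
  by rewrite -expRM_natl ler_expR natrM; lra.
set a := M%:R * K * d%:R * l in hJ *.
have la : M%:R * l <= a.
  rewrite /a -!mulrA ler_wpM2l// mulrA -{1}[l]mul1r ler_wpM2r//.
  by rewrite -[leLHS]mulr1 ler_pM.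
have da : d%:R * l <= a.
  by rewrite /a ler_wpM2r// -{1}[d%:R]mul1r ler_wpM2r// -[leLHS]mulr1 ler_pM.
have hM : M%:R <= expR (2 * a).
  rewrite (le_trans (le_expR_ln n2 (ler0n _ M)))// ler_expR -mulrA.
  by rewrite ler_wpM2l.
have hd : 2 ^+ d <= expR a by rewrite (le_trans (two_pow_le_expR d n2))// ler_expR.
rewrite natrM (@le_trans _ _ (expR (13 * a) * expR (2 * a) * expR a * expR (- (18 * a))))//.
  rewrite ler_wpM2r ?expR_ge0//; do 2?apply: ler_pM => //.
rewrite -!expRD ler_expR; lra.
Qed.

(** 5 = 1 + 1 + 1 + 2: one unit for each of the three prefactors, two for the remaining decay. *)
Lemma sample_failure_bound n d K : (2 <= n)%N -> (1 <= d)%N -> 1 <= K ->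
  n%:R * expR (K ^+ 2 / 2) * 2 ^+ d * expR (- (5 * (K ^+ 2 * d%:R * ln n%:R))) <=
  expR (- (2 * (d%:R * ln n%:R))) :> R.
Proof.
move=> n2 d1 K1; rewrite -{1}(expR_ln_nat n2).
have l2 := ln_nat_ge_half n2; set l := ln _ in l2 *.
have l0 : 0 <= l by exact: le_trans l2.
have K2 : 1 <= K ^+ 2 by rewrite expr_ge1// (le_trans _ K1).
have dR : 1 <= d%:R :> R by rewrite ler1n.
set a := K ^+ 2 * d%:R * l.
have da : d%:R * l <= a by rewrite /a -mulrA ler_peMl// mulr_ge0.
have la : l <= a by rewrite (le_trans _ da)// ler_peMl.
have Ka : K ^+ 2 / 2 <= a.
  rewrite /a -mulrA ler_wpM2l ?sqr_ge0//.
  by rewrite (le_trans l2)// ler_peMl.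
apply: (@le_trans _ _ (expR l * expR (K ^+ 2 / 2) * expR (d%:R * l) * expR (- (5 * a)))).
  rewrite ler_wpM2r ?expR_ge0// ler_wpM2l ?mulr_ge0 ?expR_ge0//.
  exact: two_pow_le_expR.
rewrite -!expRD ler_expR; lra.
Qed.

(** With [n < d], the prefactors use at most three units of [K ^+ 2 * d * ln n], and more than
    enough decay is left. *)
Lemma small_failure_bound n d K : (2 <= n)%N -> (n < d)%N -> 1 <= K ->
  (2 * expR (K ^+ 2 / 2)) ^+ n * 2 ^+ d * expR (- (7 * (K ^+ 2 * d%:R * ln n%:R))) <=
  expR (- (d%:R * ln n%:R)) :> R.
Proof.
move=> n2 nd K1.
have l2 := ln_nat_ge_half n2; set l := ln _ in l2 *.
have l0 : 0 <= l by exact: le_trans l2.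
have K2 : 1 <= K ^+ 2 by rewrite expr_ge1// (le_trans _ K1).
have dR : 1 <= d%:R :> R by rewrite ler1n (leq_trans _ nd).
set a := K ^+ 2 * d%:R * l.
have da : d%:R * l <= a by rewrite /a -mulrA ler_peMl// mulr_ge0.
have Ka : n%:R * (K ^+ 2 / 2) <= a.
  rewrite /a mulrA; apply: ler_pM => //; first by rewrite mulr_ge0// sqr_ge0.
  by rewrite mulrC ler_wpM2l ?sqr_ge0// ler_nat ltnW.
have h2n : 2 ^+ n <= 2 ^+ d :> R by rewrite ler_weXn2l ?ler1n// ltnW.
have h2d : 2 ^+ d <= expR (d%:R * l) := two_pow_le_expR d n2.
rewrite exprMn -expRM_natl.
apply: (@le_trans _ _ (expR (d%:R * l) * expR (n%:R * (K ^+ 2 / 2)) *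
    expR (d%:R * l) * expR (- (7 * a)))).
  rewrite ler_wpM2r ?expR_ge0//; apply: ler_pM => //.
  by rewrite ler_wpM2r ?expR_ge0// (le_trans h2n).
have a0 : 0 <= a by rewrite (le_trans _ da)// mulr_ge0.
rewrite -!expRD ler_expR; lra.
Qed.

End numeric_bounds.

(** * The uniform bound *)

(** Covers both regimes: for [d <= n], [12 * (1 + subgaussian_variance R)] on the net plus
    [48 * expR (3 / 2) + 336] for discretisation; for [n < d], [12 + 2 * subgaussian_mean R]. *)
Definition gap_constant (R : realType) : R :=
  12 * (1 + subgaussian_variance R) + 48 * expR (3 / 2) +
  2 * subgaussian_mean R + 400.

Lemma subgaussian_mean_ge0 (R : realType) : 0 <= subgaussian_mean R.
Proof. by rewrite mulr_ge0// expR_ge0. Qed.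

Lemma subgaussian_variance_ge0 (R : realType) : 0 <= subgaussian_variance R.
Proof.
by rewrite !addr_ge0 ?subgaussian_mean_ge0// mulr_ge0// expR_ge0.
Qed.

Lemma probability_setI_ge d (T : measurableType d) (R : realType)
    (P : probability T R) (A B : set T) (a b : R) :
  measurable A -> measurable B ->
  ((1 - a)%:E <= P A)%E -> ((1 - b)%:E <= P B)%E ->
  ((1 - (a + b))%:E <= P (A `&` B))%E.
Proof.
move=> mA mB PA PB.
have fin C : measurable C -> P C \is a fin_num by exact: fin_num_measure.
have mAB : measurable (A `&` B) by exact: measurableI.
have nle (C : set T) c : measurable C -> ((1 - c)%:E <= P C)%E -> (P (~` C) <= c%:E)%E.
  move=> mC; rewrite probability_setC// -(fineK (fin _ mC)) -EFinB !lee_fin; lra.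
have : (P (~` (A `&` B)) <= (a + b)%:E)%E.
  rewrite setCI EFinD; apply: le_trans (measureU2 _ _ _) _.
  - exact: measurableC.
  - exact: measurableC.
  - by apply: leeD; exact: nle.
rewrite probability_setC// -(fineK (fin _ mAB)) -EFinB !lee_fin; lra.
Qed.

Section uniform_gap.
Context (R : realType) (M d n : nat) (pi : 'I_M -> R) (K : R).
Variable Q : probability (d.-tuple R) R.
Context (dO : measure_display) (O : measurableType dO) (P : probability O R).
Variable X : 'I_n -> O -> d.-tuple R.
Hypothesis mX : forall j, measurable_fun setT (X j).
Hypothesis lawX : forall j (A : set (d.-tuple R)), measurable A ->
  P (X j @^-1` A) = Q A.
Hypothesis indX : mutually_independent P X.
Hypothesis pi0 : forall i, 0 < pi i.
Hypotheses (M1 : (1 <= M)%N) (d1 : (1 <= d)%N) (n2 : (2 <= n)%N) (K1 : 1 <= K).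
Hypothesis mgfQ : forall v : 'I_d -> R,
  (\int[Q]_x (expR (\sum_k v k * tnth x k))%:E <=
   (expR (K * enorm v + enorm v ^+ 2 / 2))%:E)%E.

Local Notation l := (ln n%:R : R).
Local Notation rate := (Num.sqrt (d%:R * l / n%:R)).
Local Notation gap w i mu :=
  (fun k => Gpop pi Q i mu k - Gemp pi (fun j => X j w) i mu k).

Let n0 : (0 < n)%N. Proof. exact: leq_trans n2. Qed.
Let n0R : 0 < n%:R :> R. Proof. by rewrite ltr0n. Qed.
Let K0 : 0 < K. Proof. exact: lt_le_trans K1. Qed.
Let l2 : 2^-1 <= l. Proof. exact: ln_nat_ge_half. Qed.
Let l0 : 0 <= l. Proof. exact: le_trans l2. Qed.
Let dR : 1 <= d%:R :> R. Proof. by rewrite ler1n. Qed.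
Let rate_sqr : rate ^+ 2 = d%:R * l / n%:R.
Proof. by rewrite sqr_sqrtr// divr_ge0// mulr_ge0. Qed.
Let sqrtM1 : 1 <= Num.sqrt M%:R :> R.
Proof. by rewrite -[leLHS]sqrtr1 ler_wsqrtr// ler1n. Qed.
Let K2 : 1 <= K ^+ 2. Proof. by rewrite expr_ge1// ltW. Qed.

(** Since [d / n >= 1] and [ln n >= 1/2], the rate is at least [1/2] and absorbs every term of order
    [K]. The gap is split into [Gpop], the weighted sum [S] and the averaged center [m], bounded
    separately. *)
Lemma uniform_gap_small : (n < d)%N -> exists E : set O, [/\ measurable E,
  ((1 - expR (- (d%:R * l)))%:E <= P E)%E &
  forall w, E w -> forall mu, (forall i, enorm (mu i) <= 2 * K) -> forall i,
    enorm (gap w i mu) <= gap_constant R * (Num.sqrt M%:R * K ^+ 2 * rate)].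
Proof.
move=> nd.
have [E [mE PE HE]] := weighted_sum_bound mX lawX indX mgfQ
  (7 * (K ^+ 2 * d%:R * l)) n0.
exists E; split => //.
  by apply: le_trans PE; rewrite lee_fin lerB// small_failure_bound.
move=> w Ew mu muK i.
have rate_half : 2^-1 <= rate.
  rewrite -(@ler_pXn2r _ 2)// ?nnegrE ?sqrtr_ge0// rate_sqr.
  rewrite ler_pdivlMr//; apply: (@le_trans _ _ (2^-1 * d%:R)); last first.
    by rewrite mulrC ler_wpM2l// (le_trans _ dR).
  have : n%:R <= d%:R :> R by rewrite ler_nat ltnW.
  have : 0 < d%:R :> R by exact: lt_le_trans dR.
  by rewrite expr2; lra.
pose t j := wgt pi i (tnth (X j w)) mu.
have t01 j : 0 <= t j <= 1 by rewrite wgt_ge0// wgt_le1.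
have hG : enorm (Gpop pi Q i mu) <= K * subgaussian_mean R.
  apply: (enorm_weighted_displacement K1 mgfQ) => //.
  - exact: measurable_wgt.
  - by move=> x; exact: wgt_ge0.
  - by move=> x; exact: wgt_le1.
pose S k := n%:R^-1 * \sum_j t j * tnth (X j w) k.
pose m k := (n%:R^-1 * \sum_j t j) * mu i k.
have GempE k : Gemp pi (fun j => X j w) i mu k = S k - m k.
  rewrite /Gemp /S /m -mulrA -mulrBr mulr_suml -sumrB; congr (_ * _).
  by apply: eq_bigr => j _; rewrite mulrBr.
have hS : enorm S <= 8 * (K * rate).
  rewrite /S enormZ ger0_norm ?invr_ge0//.
  rewrite -(@ler_pXn2r _ 2)// ?nnegrE ?mulr_ge0 ?invr_ge0 ?enorm_ge0 ?sqrtr_ge0 ?(ltW K0)//.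
  rewrite exprMn; apply: le_trans (ler_wpM2l _ (HE w Ew t t01)) _.
    by rewrite sqr_ge0.
  rewrite !exprMn rate_sqr.
  have h : 0 <= K ^+ 2 * (d%:R * l / n%:R).
    by rewrite mulr_ge0 ?sqr_ge0// divr_ge0// mulr_ge0.
  rewrite [leLHS](_ : _ = 56 * (K ^+ 2 * (d%:R * l / n%:R))); first lra.
  by field; rewrite gt_eqF.
have hm : enorm m <= 2 * K.
  rewrite /m enormZ (le_trans _ (muK i))// ler_piMl ?enorm_ge0//.
  rewrite normrM ger0_norm ?invr_ge0// ler_pdivrMl// mulr1.
  rewrite ger0_norm; last by apply: sumr_ge0 => j _; case/andP: (t01 j).
  rewrite -[n in leRHS]card_ord -sum1_card natr_sum; apply: ler_sum => j _.
  by case/andP: (t01 j).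
have hK : K <= 2 * (K * rate).
  by have := ler_wpM2l (ltW K0) rate_half; lra.
apply: (@le_trans _ _ ((12 + 2 * subgaussian_mean R) * (K * rate))).
  under eq_fun do rewrite GempE.
  apply: le_trans (le_enormB _ _) _.
  have := le_enormB S m; have c0 := subgaussian_mean_ge0 R.
  have := ler_wpM2l c0 hK; lra.
have r0 : 0 <= rate by exact: sqrtr_ge0.
have hKr : K * rate <= Num.sqrt M%:R * K ^+ 2 * rate.
  rewrite ler_wpM2r// -[leLHS]mul1r ler_pM ?(ltW K0)//.
  by rewrite expr2 ler_peMl// ltW.
apply: ler_pM => //.
- by rewrite addr_ge0// mulr_ge0// subgaussian_mean_ge0.
- by rewrite mulr_ge0// ltW.
- have := subgaussian_variance_ge0 R; have := expR_ge0 (3 / 2 : R).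
  rewrite /gap_constant; lra.
Qed.

Lemma uniform_gap_large : (d <= n)%N -> exists E : set O, [/\ measurable E,
  ((1 - expR (- (d%:R * l)))%:E <= P E)%E &
  forall w, E w -> forall mu, (forall i, enorm (mu i) <= 2 * K) -> forall i,
    enorm (gap w i mu) <= gap_constant R * (Num.sqrt M%:R * K ^+ 2 * rate)].
Proof.
move=> dn.
have nR : 1 <= n%:R :> R by rewrite ler1n.
(* The factor [K ^+ 2] in the denominator cancels that of the Lipschitz constant; [2 * K / h] is
   then the quantity rounded up in [N]. *)
pose h : R := (n%:R ^+ 4 * K ^+ 2)^-1.
have D0 : 0 < n%:R ^+ 4 * K ^+ 2 by rewrite mulr_gt0// exprn_gt0.
have h0 : 0 < h by rewrite invr_gt0.
pose N := (Num.truncn (2 * K ^+ 3 * n%:R ^+ 4)).+1.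
have q0 : 0 <= 2 * K ^+ 3 * n%:R ^+ 4 by rewrite !mulr_ge0// ?exprn_ge0// ltW.
have /andP[N1 N2] := truncn_itv q0.
have KN : 2 * K <= N%:R * h.
  rewrite ler_pdivlMr// (le_trans _ (ltW N2))//.
  by rewrite le_eqVlt; apply/orP; left; apply/eqP; ring.
have [J [c [cardJ cK cnet]]] := ball_net M d h0 KN.
have [||||E1 [mE1 PE1 HE1]] := finite_family_concentration (J := (J * 'I_M)%type) mX lawX indX
  K1 mgfQ (W := fun p x => wgt pi p.2 (tnth x) (c p.1))
  (m := fun p => c p.1 p.2) (18 * (M%:R * K * d%:R * l)) n0.
- by move=> p; exact: measurable_wgt.
- by move=> p x; exact: wgt_ge0.
- by move=> p x; exact: wgt_le1.
- by move=> p; exact: cK.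
have [E2 [mE2 PE2 HE2]] := sample_norm_bound mX lawX mgfQ
  (5 * (K ^+ 2 * d%:R * l)).
exists (E1 `&` E2); split; first exact: measurableI.
  apply: (le_trans _ (probability_setI_ge mE1 mE2 PE1 PE2)).
  rewrite lee_fin lerB//; apply: (le_trans _ (expR_failure_sum R n2 d1)).
  apply: lerD; last exact: sample_failure_bound.
  rewrite card_prod card_ord; apply: (net_failure_bound n2 M1 d1 K1 cardJ).
  by rewrite /N -natr1 lerD2r.
move=> w [E1w E2w] mu muK i.
have [j jnet] := cnet mu muK.
have r0 : 0 <= rate by exact: sqrtr_ge0.
have C0 := subgaussian_variance_ge0 R.
(* [8 * 18 = 144 = 12 ^+ 2], and [V <= (1 + V) ^+ 2] avoids a square root of the variance. The [K]
   in the exponent makes [K ^+ 3], rounded up to [K ^+ 4]. *)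
have gap_net : enorm (gap w i (c j)) <=
    12 * (1 + subgaussian_variance R) * (Num.sqrt M%:R * K ^+ 2 * rate).
  rewrite -(@ler_pXn2r _ 2)// ?nnegrE ?enorm_ge0//; last first.
    apply: mulr_ge0; first by rewrite mulr_ge0// addr_ge0.
    by rewrite mulr_ge0// mulr_ge0 ?sqr_ge0 ?sqrtr_ge0.
  apply: le_trans (HE1 w E1w (j, i)) _.
  rewrite !exprMn rate_sqr sqr_sqrtr//.
  set V := subgaussian_variance R in C0 *.
  have e0 : 0 <= M%:R * (d%:R * l / n%:R) :> R.
    by rewrite mulr_ge0// divr_ge0// mulr_ge0.
  have K34 : K ^+ 3 <= (K ^+ 2) ^+ 2 by rewrite -exprM ler_weXn2l.
  have V2 : V <= (1 + V) ^+ 2 by have := sqr_ge0 V; lra.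
  have h1 : V * K ^+ 3 <= (1 + V) ^+ 2 * (K ^+ 2) ^+ 2.
    by apply: ler_pM => //; rewrite exprn_ge0// ltW.
  have h2 := ler_wpM2r e0 h1.
  rewrite [leLHS](_ : _ =
    144 * (V * K ^+ 3 * (M%:R * (d%:R * l / n%:R)))); first lra.
  by field; rewrite gt_eqF.
pose b := Num.sqrt d%:R * h *
  (6 * (d%:R * (4 * expR (3 / 2) * K ^+ 2)) + 6 * (8 * (5 * (K ^+ 2 * d%:R * l)))
   + 48 * K ^+ 2).
have diff_k k : `|gap w i mu k - gap w i (c j) k| <= b.
  exact: (gap_lipschitz pi0 K1 n0 mgfQ i k muK (cK j) jnet (HE2 w E2w)).
(* One [sqrt d] comes from the mesh, the other from passing from coordinates to the norm. The total
   is of order [d ^+ 2 * l / n ^+ 4], at most [l / n ^+ 2] because [d <= n]. *)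
have hb : Num.sqrt d%:R * b <= (48 * expR (3 / 2) + 336) * rate.
  rewrite /b mulrA mulrA -expr2 sqr_sqrtr//.
  set e := expR _; have e0 : 0 <= e by exact: expR_ge0.
  have dl : 1 <= 2 * (d%:R * l).
    by have := ler_pM _ _ dR l2; rewrite mul1r => /(_ ler01 _) ; lra.
  have dl' : d%:R <= 2 * (d%:R * l).
    by have := ler_wpM2l (ler0n R d) l2; lra.
  have K2' : 0 <= K ^+ 2 by exact: sqr_ge0.
  apply: (@le_trans _ _ (d%:R * h * (K ^+ 2 * ((48 * e + 336) * (d%:R * l))))).
    rewrite ler_wpM2l ?mulr_ge0// ?(ltW h0)//.
    have := ler_wpM2l (mulr_ge0 K2' e0) dl'.
    have := ler_wpM2l K2' dl; lra.
  have -> : d%:R * h * (K ^+ 2 * ((48 * e + 336) * (d%:R * l))) =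
      (48 * e + 336) * ((d%:R * d%:R) * l / n%:R ^+ 4).
    by rewrite /h; field; rewrite !gt_eqF// exprn_gt0.
  rewrite ler_wpM2l//; first by lra.
  have hdn : d%:R <= n%:R :> R by rewrite ler_nat.
  have hln : l <= n%:R by rewrite ltW// ln_sublinear.
  apply: (@le_trans _ _ (l / n%:R ^+ 2)).
    rewrite ler_pdivrMr ?exprn_gt0//.
    rewrite (_ : l / _ * _ = (n%:R * n%:R) * l); last first.
      by field; rewrite gt_eqF.
    by rewrite ler_wpM2r// ler_pM.
  rewrite -(@ler_pXn2r _ 2)// ?nnegrE ?sqrtr_ge0 ?divr_ge0 ?exprn_ge0//.
  rewrite rate_sqr expr_div_n ler_pdivrMr ?exprn_gt0//.
  rewrite (_ : _ / _ * _ = d%:R * (l * n%:R ^+ 3)); last first.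
    by field; rewrite gt_eqF.
  rewrite -[leLHS]mul1r ler_pM ?sqr_ge0// expr2 ler_wpM2l//.
  by rewrite (le_trans hln)// -[leLHS]expr1 ler_weXn2l.
have hr : rate <= Num.sqrt M%:R * K ^+ 2 * rate.
  by rewrite ler_peMl// -[leLHS]mulr1 ler_pM.
apply: (@le_trans _ _ (enorm (gap w i (c j)) +
    enorm (fun k => gap w i mu k - gap w i (c j) k))).
  rewrite (_ : gap w i mu = fun k => gap w i (c j) k +
      (gap w i mu k - gap w i (c j) k)); first exact: le_enormD.
  by apply/funext => k; ring.
apply: (le_trans (lerD gap_net (le_trans (enorm_le_coord diff_k) hb))).
have e0 : 0 <= 48 * expR (3 / 2) + 336 :> R by have := expR_ge0 (3 / 2 : R); lra.
have := ler_wpM2l e0 hr; have := le_trans r0 hr => hr0.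
have := mulr_ge0 (subgaussian_mean_ge0 R) hr0.
rewrite /gap_constant; lra.
Qed.

Lemma uniform_gap : exists E : set O, [/\ measurable E,
  ((1 - expR (- (d%:R * l)))%:E <= P E)%E &
  forall w, E w -> forall mu, (forall i, enorm (mu i) <= 2 * K) -> forall i,
    enorm (gap w i mu) <= gap_constant R * (Num.sqrt M%:R * K ^+ 2 * rate)].
Proof.
have [dn|nd] := leqP d n; first exact: uniform_gap_large.
exact: uniform_gap_small.
Qed.

End uniform_gap.

Theorem theorem8 (R : realType) :
  exists C0 C1 c c' : R, 0 < C0 /\ 0 < C1 /\ 0 < c /\ 0 < c' /\
  forall (M d n : nat) (pi : 'I_M -> R) (mus : 'I_M -> 'I_d -> R) (a : R)
    (dO : measure_display) (O : measurableType dO) (P : probability O R)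
    (gmm : probability (d.-tuple R) R) (X : 'I_n -> O -> d.-tuple R),
  (2 <= M)%N -> (1 <= d)%N -> (1 <= n)%N ->
  (forall i, 0 < pi i) -> \sum_(i < M) pi i = 1 ->
  (forall k, \sum_(i < M) pi i * mus i k = 0) ->
  let d0 := minn d M in
  let L := Num.max (M%:R ^+ 2 * kappa pi / pimin pi)
             (Num.max (Rmax mus) d0%:R) in
  C0 * Num.sqrt d0%:R * Num.sqrt (ln L) <= Rmin mus ->
  a <= Rmin mus / 2 - Num.sqrt d0%:R * (C1 * Num.sqrt (ln L)) ->
  is_GMM_law pi mus gmm ->
  (forall j, measurable_fun setT (X j)) ->
  (forall j (A : set (d.-tuple R)), measurable A -> P (X j @^-1` A) = gmm A) ->
  mutually_independent P X ->
  exists E : set O, measurable E /\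
    (E `<=` [set w | forall i : 'I_M,
       (ereal_sup [set (enorm (fun k => Gpop pi gmm i mu k
                                    - Gemp pi (fun j => X j w) i mu k))%:E
                  | mu in ballsA mus a]
        < (eps_unif c n pi mus : R)%:E)%E]) /\
    (P E >= (1 - expR (- (c' * d%:R * ln n%:R)))%:E)%E.
Proof.
(* The added 1 makes the bound on the supremum strict. *)
exists 1, 1, (gap_constant R + 1), 1.
have c0 : 0 <= gap_constant R.
  have := subgaussian_variance_ge0 R; have := subgaussian_mean_ge0 R.
  have := expR_ge0 (3 / 2 : R); rewrite /gap_constant; lra.
do 2!(split; first exact: ltr01); split; first lra; split; first exact: ltr01.
move=> M d n pi mus a dO O P gmm X M2 d1 n1 pi0 pi1 mean0 d0 L _ aR law mX lawX indX.
rewrite mul1r; have [n2|] := leqP 2 n; last first.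
  rewrite ltnS => n1'; have nE : n = 1%N by apply/eqP; rewrite eqn_leq n1' n1.
  (* For [n = 1], [ln n = 0]: the required probability is zero, and so is [eps_unif], hence the
     empty event. *)
  exists set0; split; first exact: measurable0.
  split; first exact: sub0set.
  by rewrite [in ln _]nE ln1 mulr0 oppr0 expR0 subrr measure0.
have R0 : 0 <= Rmax mus by exact: bigmax_ge_id.
have aR2 : a <= Rmax mus / 2.
  apply: le_trans aR _.
  have : Rmin mus <= Rmax mus by exact: bigmin_le_id.
  have : 0 <= Num.sqrt d0%:R * (1 * Num.sqrt (ln L)).
    by rewrite mulr_ge0 ?mul1r ?sqrtr_ge0.
  lra.
pose K := 1 + Rmax mus.
have K1 : 1 <= K by rewrite lerDl.
have musR i : enorm (mus i) <= Rmax mus by exact: (enorm_mean_le i pi0 pi1 mean0).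
have musK i : enorm (mus i) <= K by rewrite (le_trans (musR i))// lerDr.
have mgfQ v := gmm_mgf v pi0 pi1 law musK.
have [E [mE PE HE]] := uniform_gap mX lawX indX pi0 (ltnW M2) d1 n2 K1 mgfQ.
exists E; split; first exact: mE.
split; last exact: PE.
move=> w Ew i.
pose rate : R := Num.sqrt (d%:R * ln n%:R / n%:R).
have rate0 : 0 < rate.
  rewrite sqrtr_gt0 divr_gt0 ?ltr0n// mulr_gt0 ?ltr0n//.
  exact: lt_le_trans (ln_nat_ge_half R n2).
apply: (@le_lt_trans _ _ (gap_constant R * (Num.sqrt M%:R * K ^+ 2 * rate))%:E).
  apply: ge_ereal_sup => _ [mu muA <-]; rewrite lee_fin; apply: HE => // j.
  rewrite (_ : mu j = fun k => mus j k + (mu j k - mus j k)); last first.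
    by apply/funext => k; ring.
  have := le_enormD (mus j) (fun k => mu j k - mus j k).
  by have := muA j; have := musR j; rewrite /K; lra.
have M1 : 1 <= M%:R :> R by rewrite ler1n (leq_trans _ M2).
have K3 : K ^+ 2 <= (1 + 3 * Rmax mus) ^+ 3.
  apply: (@le_trans _ _ (K ^+ 3)); first by rewrite ler_weXn2l.
  by rewrite lerXn2r ?nnegrE /K; lra.
have K20 : 0 < K ^+ 2 by rewrite exprn_gt0// (lt_le_trans _ K1).
set s := Num.sqrt M%:R; have s0 : 0 < s by rewrite sqrtr_gt0 (lt_le_trans _ M1).
have h : s * K ^+ 2 * rate <=
    M%:R * s * (1 + 3 * Rmax mus) ^+ 3 * Num.max 1 (ln (kappa pi)) * rate.
  rewrite ler_wpM2r ?(ltW rate0)// -[leLHS]mulr1; apply: ler_pM => //.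
  - by rewrite mulr_ge0// ltW.
  - by apply: ler_pM => //; rewrite ?ler_peMl// ltW.
  - by rewrite le_max lexx.
have pos : 0 < s * K ^+ 2 * rate by do 2?apply: mulr_gt0.
rewrite lte_fin /eps_unif -/rate -/s.
have := ler_wpM2l c0 h; lra.
Qed.
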